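(* Let $L$ be a complete differential graded Lie algebra over $\mathbb{Q}$, concentrated in degree $0$ (so its differential is $0$). Let $\exp L$ be the group whose underlying set is $L$ and whose product is the Baker-Campbell-Hausdorff product $*$. Let $\langle L\rangle=\mathrm{Hom}_{\mathbf{cdgl}}(\mathfrak{L}_\bullet,L)$ be the spatial realization of $L$, where $\mathfrak{L}_\bullet$ is the cosimplicial complete differential graded Lie algebra described in the context. Then the simplicial set $\langle L\rangle$ is isomorphic, as a simplicial set, to the simplicial bar construction $B_\bullet(\exp L)$ on the group $\exp L$.
   Context: **Complete differential graded Lie algebras.** All vector spaces are over $\mathbb{Q}$; gradings are by $\mathbb{Z}$ and differentials $d$ lower degree by $1$. A complete differential graded Lie algebra (cdgl) is a differential graded Lie algebra $L$ with a decreasing filtration $L=F^1\supseteq F^2\supseteq\cdots$ by differential Lie ideals with $[F^p,F^q]\subseteq F^{p+q}$ such that the natural map $L\to\varprojlim_n L/F^n$ is an isomorphism. Morphisms are the filtration-preserving morphisms of differential graded Lie algebras; the category is denoted $\mathbf{cdgl}$. A Maurer-Cartan element is an element $a$ of degree $-1$ with $da=-\frac12[a,a]$. **Baker-Campbell-Hausdorff product.** For elements $a,b$ of degree $0$ in a cdgl, $a*b=\log(e^{a}e^{b})$ is the Baker-Campbell-Hausdorff series, which converges by completeness. It defines a group structure on the degree $0$ part, with identity $0$ and inverse $a^{-1}=-a$. If $L$ is a cdgl concentrated in degree $0$, $\exp L$ denotes the group $(L,* )$. **Free complete Lie algebras.** For a finite dimensional graded vector space $V$, let $\mathbb{L}(V)$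 be the free graded Lie algebra on $V$, $\mathbb{L}^{\ge n}(V)$ the ideal generated by the Lie brackets of length $\ge n$, and $\widehat{\mathbb{L}}(V)=\varprojlim_n\mathbb{L}(V)/\mathbb{L}^{\ge n}(V)$ the free complete graded Lie algebra on $V$, filtered by bracket length. **The cosimplicial cdgl $\mathfrak{L}_\bullet$.** This is the cosimplicial cdgl constructed by Buijs, Félix, Murillo and Tanré (its existence is known and is taken as given). As a graded Lie algebra, $\mathfrak{L}_n$ ($n\ge 0$) is the free complete graded Lie algebra on the rational vector space with basis the elements $a_{i_0\dots i_k}$, for $0\le i_0<\dots<i_k\le n$ (and $0\le k\le n$), with degree $|a_{i_0\dots i_k}|=k-1$. Write $\mathrm{ad}_{i_0\dots i_k}=[a_{i_0\dots i_k},-]$. Its differential $d$ has the following properties. - Each $a_r$ is a Maurer-Cartan element: $da_r=-\frac12[a_r,a_r]$. - For $r<s$, the triple $(a_r,a_s,a_{rs})$ is a Lawrence-Sullivan interval: $$da_{rs}=[a_{rs},a_s]+\frac{\mathrm{ad}_{rs}}{e^{\mathrm{ad}_{rs}}-1}(a_s-a_r).$$ - For $r<s<t$, $$da_{rst}=a_{rs}*a_{st}*a_{rt}^{-1}-[a_r,a_{rst}].$$ No explicit formula is specified for $da_{i_0\dots i_k}$ with $k\ge 3$. The cofaces $\delta^i:\mathfrak{L}_{n-1}\to\mathfrak{L}_n$ and codegeneracies $\sigma^i:\mathfrak{L}_{n+1}\to\mathfrak{L}_n$ ($0\le i\le n$) are the cdgl morphisms given on generators as follows. - $\delta^i a_{i_0\dots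 i_p}=a_{j_0\dots j_p}$, with $j_k=i_k$ if $i_k<i$ and $j_k=i_k+1$ if $i_k\ge i$. - $\sigma^i a_{i_0\dots i_p}=0$ if $\{i,i+1\}\subset\{i_0,\dots,i_p\}$; otherwise $\sigma^i a_{i_0\dots i_p}=a_{j_0\dots j_p}$, with $j_k=i_k$ if $i_k\le i$ and $j_k=i_k-1$ if $i_k>i$. **Spatial realization.** For a cdgl $L$, $\langle L\rangle$ is the simplicial set with $\langle L\rangle_n=\mathrm{Hom}_{\mathbf{cdgl}}(\mathfrak{L}_n,L)$, faces $d_i f=f\circ\delta^i$ and degeneracies $s_i f=f\circ\sigma^i$. **Simplicial bar construction.** For a group $G$ with identity $e$, $B_\bullet G$ is the simplicial set with $B_nG=G^n$, with elements written $[g_1|\dots|g_n]$. Its faces are $d_0[g_1|\dots|g_n]=[g_2|\dots|g_n]$, $d_i[g_1|\dots|g_n]=[g_1|\dots|g_ig_{i+1}|\dots|g_n]$ for $0<i<n$, and $d_n[g_1|\dots|g_n]=[g_1|\dots|g_{n-1}]$. Its degeneracies insert the identity: $s_i[g_1|\dots|g_n]=[g_1|\dots|g_i|e|g_{i+1}|\dots|g_n]$ for $0\le i\le n$. *)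

(* Defs.v *)
From HB Require Import structures.
From mathcomp Require Import all_boot all_order all_algebra.
From mathcomp Require Import boolp classical_sets zify.

Set Implicit Arguments.
Unset Strict Implicit.
Unset Printing Implicit Defensive.

Import Order.TTheory GRing.Theory Num.Theory.
Local Open Scope ring_scope.

(* A graded rational vector space is represented by its total space [V], the
   direct sum of its homogeneous parts [gr i].  An element has finitely many
   homogeneous components, so limits and completeness are taken degree by
   degree, as usual for graded objects. *)

Definition subspace (V : lmodType rat) (A : set V) : Prop :=
  A 0 /\ forall (c : rat) x y, A x -> A y -> A (c *: x + y).

Definition graded_subset (V : lmodType rat) (gr : int -> set V) (A : set V) :=
  forall x, A x -> exists (s : seq int) (c : int -> V),
    (forall i, gr i (c i) /\ A (c i)) /\ x = \sum_(i <- s) c i.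

Record is_grading (V : lmodType rat) (gr : int -> set V) : Prop := {
  gr_subspace : forall i, subspace (gr i);
  gr_span : graded_subset gr setT;
  gr_indep : forall (s : seq int) (c : int -> V), uniq s ->
    (forall i, gr i (c i)) -> \sum_(i <- s) c i = 0 ->
    forall i, i \in s -> c i = 0
}.

Record glie := Glie {
  glie_sort :> lmodType rat;
  gr : int -> set glie_sort;
  br : glie_sort -> glie_sort -> glie_sort;
  grP : is_grading gr;
  br_linearl : forall y, linear (br^~ y);
  br_linearr : forall x, linear (br x);
  br_gr : forall i j x y, gr i x -> gr j y -> gr (i + j) (br x y);
  br_antisym : forall i j x y, gr i x -> gr j y ->
    br x y = - ((-1) ^ (i * j) *: br y x);
  br_jacobi : forall i j x y z, gr i x -> gr j y ->
    br x (br y z) = br (br x y) z + (-1) ^ (i * j) *: br y (br x z)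
}.
Arguments gr {g} _ _.
Arguments br {g} _ _.

Record is_glie_hom (P M : glie) (f : P -> M) : Prop := {
  glie_hom_linear : linear f;
  glie_hom_gr : forall i x, gr i x -> gr i (f x);
  glie_hom_br : forall x y, f (br x y) = br (f x) (f y)
}.

Record is_lie_ideal (L : glie) (A : set L) : Prop := {
  ideal_subspace : subspace A;
  ideal_graded : graded_subset gr A;
  ideal_br : forall x y, A y -> A (br x y)
}.

(* The filtration is indexed from 1; the value at 0 is a padding, forced by
   [filt1] and [filt_decr] to be the whole algebra.  The last two fields say
   that L -> lim_n L / F^n is, in each degree, injective and surjective, an
   element of the limit being given by representatives [x n] of its components
   in L / F^n. *)

Record cdgl := Cdgl {
  cdgl_glie :> glie;
  diff : cdgl_glie -> cdgl_glie;
  filt : nat -> set cdgl_glie;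
  diff_linear : linear diff;
  diff_gr : forall i x, gr i x -> gr (i - 1) (diff x);
  diff_diff : forall x, diff (diff x) = 0;
  diff_br : forall i x y, gr i x ->
    diff (br x y) = br (diff x) y + (-1) ^ i *: br x (diff y);
  filt1 : filt 1 = setT;
  filt_decr : forall n, (filt n.+1 `<=` filt n)%classic;
  filt_ideal : forall n, is_lie_ideal (filt n);
  filt_diff : forall n x, filt n x -> filt n (diff x);
  filt_br : forall p q x y, filt p x -> filt q y -> filt (p + q)%N (br x y);
  filt_inj : forall k x, gr k x -> (forall n, filt n x) -> x = 0;
  filt_surj : forall k (x : nat -> cdgl_glie), (forall n, gr k (x n)) ->
    (forall n, filt n (x n.+1 - x n)) ->
    exists2 y, gr k y & forall n, filt n (y - x n)
}.
Arguments diff {c} _.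
Arguments filt {c} _ _.

Record is_cdgl_hom (L M : cdgl) (f : L -> M) : Prop := {
  cdgl_hom_glie : is_glie_hom f;
  cdgl_hom_diff : forall x, f (diff x) = diff (f x);
  cdgl_hom_filt : forall n x, filt n x -> filt n (f x)
}.

Record cdgl_hom (L M : cdgl) := CdglHom {
  cdgl_fun :> L -> M;
  cdgl_funP : is_cdgl_hom cdgl_fun
}.

Lemma cdgl_hom_ext (L M : cdgl) (f g : cdgl_hom L M) : f =1 g -> f = g.
Proof.
case: f g => [f fP] [g gP] /= /funext fg; subst g.
by congr CdglHom; apply: Prop_irrelevance.
Qed.

Lemma cdgl_comp_subproof (L M N : cdgl) (g : cdgl_hom M N) (f : cdgl_hom L M) :
  is_cdgl_hom (g \o f).
Proof.
case: f g => [f [[fl fg fb] fd ff]] [g [[gl gg gb] gd gf]] /=.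
split; [split|..] => /=.
- by move=> c x y /=; rewrite fl gl.
- by move=> i x /fg /gg.
- by move=> x y; rewrite fb gb.
- by move=> x; rewrite fd gd.
- by move=> n x /ff /gf.
Qed.

Definition cdgl_comp (L M N : cdgl) (g : cdgl_hom M N) (f : cdgl_hom L M) :
  cdgl_hom L N := CdglHom (cdgl_comp_subproof g f).

Definition concentrated (L : cdgl) (k : int) : Prop :=
  forall i (x : L), i != k -> gr i x -> x = 0.

Definition maurer_cartan (L : cdgl) (x : L) : Prop :=
  gr (-1) x /\ diff x = - (2^-1 *: br x x).

Definition converges (L : cdgl) (u : nat -> L) (l : L) : Prop :=
  forall n, exists N, forall m, (N <= m)%N -> filt n (l - u m).

(* Sum of a series; the default value 0 is never used below, where all the
   series converge. *)
Definition series_sum (L : cdgl) (u : nat -> L) : L :=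
  xget 0 [set l | converges (fun m => \sum_(k < m) u k) l]%classic.

(* The algebra Q<<X,Y>> of noncommutative formal power series, a series being
   the function sending a word to its coefficient; the letters X and Y are
   [true] and [false]. *)

Definition ncseries := seq bool -> rat.

Definition nc_one : ncseries := fun w => (w == [::])%:R.

Definition nc_var (b : bool) : ncseries := fun w => (w == [:: b])%:R.

Definition nc_mul (f g : ncseries) : ncseries := fun w =>
  \sum_(k < (size w).+1) f (take k w) * g (drop k w).

Definition nc_pow (f : ncseries) (n : nat) : ncseries :=
  iter n (nc_mul f) nc_one.

(* When [f] has no constant term, [nc_pow f n] vanishes on words shorter than
   [n], whence the bounds in the sums defining [nc_exp] and [nc_log]. *)
Definition nc_exp (f : ncseries) : ncseries := fun w =>
  \sum_(n < (size w).+1) (n`!)%:R^-1 * nc_pow f n w.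

Definition nc_log (f : ncseries) : ncseries := fun w =>
  \sum_(1 <= n < (size w).+1)
    (-1) ^+ n.-1 / n%:R * nc_pow (fun v => f v - nc_one v) n w.

Definition nc_bch : ncseries :=
  nc_log (nc_mul (nc_exp (nc_var true)) (nc_exp (nc_var false))).

Inductive lie_poly : Type :=
  | LieVar of bool
  | LieAdd of lie_poly & lie_poly
  | LieScale of rat & lie_poly
  | LieBr of lie_poly & lie_poly.

Fixpoint nc_of_lie (p : lie_poly) : ncseries :=
  match p with
  | LieVar b => nc_var b
  | LieAdd p q => fun w => nc_of_lie p w + nc_of_lie q w
  | LieScale c p => fun w => c * nc_of_lie p w
  | LieBr p q => fun w =>
      nc_mul (nc_of_lie p) (nc_of_lie q) w -
      nc_mul (nc_of_lie q) (nc_of_lie p) w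
  end.

Fixpoint lie_eval (L : glie) (a b : L) (p : lie_poly) : L :=
  match p with
  | LieVar c => if c then a else b
  | LieAdd p q => lie_eval a b p + lie_eval a b q
  | LieScale c p => c *: lie_eval a b p
  | LieBr p q => br (lie_eval a b p) (lie_eval a b q)
  end.

(* [P n] expresses through Lie brackets the homogeneous component of degree
   [n] of log (e^X e^Y). *)
Definition is_bch_series (P : nat -> lie_poly) : Prop :=
  forall n w, nc_of_lie (P n) w = if size w == n then nc_bch w else 0.

(* The product [a * b] of elements of degree 0.  Such [P] exist, the
   components of log (e^X e^Y) being Lie polynomials, and the sum does not
   depend on the choice of [P]. *)
Definition bch (L : cdgl) (a b : L) : L :=
  xget 0 [set c | exists2 P, is_bch_series P &
    converges (fun m => \sum_(n < m) lie_eval a b (P n)) c]%classic.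

(* To be used for L concentrated in degree 0, where [bch] is meaningful on all
   of L. *)
Record bch_group_laws (L : cdgl) : Prop := {
  bchA : associative (@bch L);
  bch0l : left_id 0 (@bch L);
  bch0r : right_id 0 (@bch L);
  bchNl : left_inverse 0 -%R (@bch L);
  bchNr : right_inverse 0 -%R (@bch L)
}.

Definition exp_group (L : cdgl) (H : bch_group_laws L) : groupType :=
  HB.pack_for groupType (GRing.Lmodule.sort (glie_sort (cdgl_glie L)))
    (isGroup.Build (GRing.Lmodule.sort (glie_sort (cdgl_glie L)))
      (bchA H) (bch0l H) (bch0r H) (bchNl H) (bchNr H)).

(* [P] is the free graded Lie algebra on the graded vector space with basis
   [v], where [v i] has degree [deg i]. *)
Definition is_free_glie (I : Type) (deg : I -> int) (P : glie) (v : I -> P) :=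
  (forall i, gr (deg i) (v i)) /\
  forall (M : glie) (m : I -> M), (forall i, gr (deg i) (m i)) ->
    exists! f : P -> M, is_glie_hom f /\ forall i, f (v i) = m i.

Inductive lie_bracket (I : Type) (P : glie) (v : I -> P) : nat -> P -> Prop :=
  | LieBracket1 i : lie_bracket v 1 (v i)
  | LieBracketD p q x y : lie_bracket v p x -> lie_bracket v q y ->
      lie_bracket v (p + q)%N (br x y).

(* The ideal generated by the brackets of length at least [n]. *)
Definition long_ideal (I : Type) (P : glie) (v : I -> P) (n : nat) : set P :=
  [set x | forall A : set P, is_lie_ideal A ->
    (forall m y, (n <= m)%N -> lie_bracket v m y -> A y) -> A x]%classic.

(* [L], being complete, is the completion lim_n P / P^{>= n} of a free
   graded Lie algebra [P], filtered by bracket length: the map [phi] induces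
   isomorphisms P / P^{>= n} -> L / F^n for all [n]. *)
Definition is_free_complete (I : Type) (deg : I -> int) (L : cdgl)
    (a : I -> L) : Prop :=
  exists (P : glie) (v : I -> P) (phi : P -> L),
    [/\ is_free_glie deg v,
        is_glie_hom phi,
        forall i, phi (v i) = a i,
        forall n x, filt n (phi x) <-> long_ideal v n x &
        forall n y, exists x, filt n (y - phi x)].

(* In the simplicial identities an index is taken in the smallest ordinal it
   ranges over, and moved to the next one by [up], which adds 1, or [stay],
   which does not change the value: for instance d_i d_{j+1} = d_j d_i for
   i <= j. *)

Definition up n (i : 'I_n) : 'I_n.+1 := lift ord0 i.
Definition stay n (i : 'I_n) : 'I_n.+1 := widen_ord (leqnSn n) i.

Record sset := Sset {
  simp :> nat -> Type;
  face : forall n, 'I_n.+2 -> simp n.+1 -> simp n;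
  degen : forall n, 'I_n.+1 -> simp n -> simp n.+1;
  face_face : forall n (i j : 'I_n.+2) (x : simp n.+2), (i <= j)%N ->
    face i (face (up j) x) = face j (face (stay i) x);
  degen_degen : forall n (i j : 'I_n.+1) (x : simp n), (i <= j)%N ->
    degen (stay i) (degen j x) = degen (up j) (degen i x);
  face_degen_lt : forall n (i : 'I_n.+2) (j : 'I_n.+1) (x : simp n.+1),
    (i <= j)%N -> face (stay i) (degen (up j) x) = degen j (face i x);
  face_degen_id : forall n (i : 'I_n.+2) (j : 'I_n.+1) (x : simp n),
    i = j :> nat \/ i = j.+1 :> nat -> face i (degen j x) = x;
  face_degen_gt : forall n (i : 'I_n.+2) (j : 'I_n.+1) (x : simp n.+1),
    (j < i)%N -> face (up i) (degen (stay j) x) = degen j (face i x)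
}.
Arguments face {s n} _ _.
Arguments degen {s n} _ _.

Definition sset_iso (X Y : sset) : Prop :=
  exists phi : forall n, X n -> Y n,
    [/\ forall n, bijective (phi n),
        forall n (i : 'I_n.+2) (x : X n.+1),
          phi n (face i x) = face i (phi n.+1 x) &
        forall n (i : 'I_n.+1) (x : X n),
          phi n.+1 (degen i x) = degen i (phi n x)].

(* The n-simplex [g_1|...|g_n] of the bar construction is the function sending
   [k : 'I_n] to g_{k+1}. *)

Section Bar.
Variable G : groupType.

(* The three branches are the positions k+1 < i, k+1 = i and k+1 > i; for
   i = 0 (resp. i = n+1) only the third (resp. the first) one occurs, and the
   first (resp. the last) entry is dropped. *)
Definition bar_face n (i : 'I_n.+2) (g : {ffun 'I_n.+1 -> G}) :
    {ffun 'I_n -> G} :=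
  [ffun k : 'I_n => if (k.+1 < i)%N then g (stay k)
                    else if k.+1 == i :> nat then (g (stay k) * g (up k))%g
                    else g (up k)].

Definition bar_degen n (i : 'I_n.+1) (g : {ffun 'I_n -> G}) :
    {ffun 'I_n.+1 -> G} :=
  [ffun k : 'I_n.+1 => oapp g 1%g (unlift i k)].

Let ext n (g : {ffun 'I_n -> G}) (m : nat) : G := oapp g 1%g (insub m).

Let extE n (g : {ffun 'I_n -> G}) k : g k = ext g k.
Proof. by rewrite /ext valK. Qed.

Let ext_face n (i : 'I_n.+2) (g : {ffun 'I_n.+1 -> G}) m : (m < n)%N ->
  ext (bar_face i g) m =
    if (m.+1 < i)%N then ext g m
    else if m.+1 == i then (ext g m * ext g m.+1)%g else ext g m.+1.
Proof.
move=> mn; rewrite -[m]/(val (Ordinal mn)) -extE ffunE !extE /=.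
by rewrite /bump leq0n add1n.
Qed.

Let ext_degen n (i : 'I_n.+1) (g : {ffun 'I_n -> G}) m : (m < n.+1)%N ->
  ext (bar_degen i g) m =
    if m == i then 1%g else if (m < i)%N then ext g m else ext g m.-1.
Proof.
move=> mn; rewrite -[m]/(val (Ordinal mn)) -extE ffunE.
case: unliftP => [k ->|->] /=; last by rewrite eqxx.
rewrite extE eq_sym (negPf (neq_bump _ _)) /bump.
by case: (leqP i k) => ik; rewrite ?add1n ?add0n ?ik // ltnNge (leqW ik).
Qed.

Let valE n : (forall i : 'I_n, up i = i.+1 :> nat) *
             (forall i : 'I_n, stay i = i :> nat).
Proof. by split=> i //=; rewrite /bump leq0n add1n. Qed.

#[local] Ltac bar_split := repeat (case: ifP => /=); intros; try lia.

#[local] Ltac bar_tac :=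
  apply/ffunP => k; rewrite !extE;
  repeat match goal with i : 'I_?m |- _ =>
    lazymatch goal with _ : is_true (nat_of_ord i < m)%N |- _ => fail
    | _ => have := ltn_ord i; move=> ? end end;
  have := ltn_ord k; move=> ?;
  first [rewrite [LHS]ext_face | rewrite [LHS]ext_degen]; rewrite ?valE; try lia;
  try first [rewrite [RHS]ext_face | rewrite [RHS]ext_degen]; rewrite ?valE;
  try lia;
  bar_split; rewrite ?ext_face ?ext_degen ?valE; try lia; bar_split;
  rewrite ?mulgA ?mulg1 ?mul1g //; do ?congr (_ * _)%g; congr (ext _ _); lia.

Lemma bar_face_face n (i j : 'I_n.+2) (g : {ffun 'I_n.+2 -> G}) :
  (i <= j)%N -> bar_face i (bar_face (up j) g) = bar_face j (bar_face (stay i) g).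
Proof. by move=> ij; bar_tac. Qed.

Lemma bar_degen_degen n (i j : 'I_n.+1) (g : {ffun 'I_n -> G}) :
  (i <= j)%N ->
  bar_degen (stay i) (bar_degen j g) = bar_degen (up j) (bar_degen i g).
Proof. by move=> ij; bar_tac. Qed.

Lemma bar_face_degen_lt n (i : 'I_n.+2) (j : 'I_n.+1)
    (g : {ffun 'I_n.+1 -> G}) : (i <= j)%N ->
  bar_face (stay i) (bar_degen (up j) g) = bar_degen j (bar_face i g).
Proof. by move=> ij; bar_tac. Qed.

Lemma bar_face_degen_id n (i : 'I_n.+2) (j : 'I_n.+1) (g : {ffun 'I_n -> G}) :
  i = j :> nat \/ i = j.+1 :> nat -> bar_face i (bar_degen j g) = g.
Proof. by case=> ij; bar_tac. Qed.

Lemma bar_face_degen_gt n (i : 'I_n.+2) (j : 'I_n.+1)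
    (g : {ffun 'I_n.+1 -> G}) : (j < i)%N ->
  bar_face (up i) (bar_degen (stay j) g) = bar_degen j (bar_face i g).
Proof. by move=> ij; bar_tac. Qed.

Definition bar : sset :=
  Sset bar_face_face bar_degen_degen bar_face_degen_lt bar_face_degen_id
    bar_face_degen_gt.

End Bar.

Record cosimplicial_cdgl := CosimplicialCdgl {
  cosimp :> nat -> cdgl;
  coface : forall n, 'I_n.+2 -> cdgl_hom (cosimp n) (cosimp n.+1);
  codegen : forall n, 'I_n.+1 -> cdgl_hom (cosimp n.+1) (cosimp n);
  coface_coface : forall n (i j : 'I_n.+2) (x : cosimp n), (i <= j)%N ->
    coface (up j) (coface i x) = coface (stay i) (coface j x);
  codegen_codegen : forall n (i j : 'I_n.+1) (x : cosimp n.+2), (i <= j)%N ->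
    codegen j (codegen (stay i) x) = codegen i (codegen (up j) x);
  codegen_coface_lt : forall n (i : 'I_n.+2) (j : 'I_n.+1) (x : cosimp n.+1),
    (i <= j)%N ->
    codegen (up j) (coface (stay i) x) = coface i (codegen j x);
  codegen_coface_id : forall n (i : 'I_n.+2) (j : 'I_n.+1) (x : cosimp n),
    i = j :> nat \/ i = j.+1 :> nat -> codegen j (coface i x) = x;
  codegen_coface_gt : forall n (i : 'I_n.+2) (j : 'I_n.+1) (x : cosimp n.+1),
    (j < i)%N -> codegen (stay j) (coface (up i) x) = coface i (codegen j x)
}.
Arguments coface {c n} _.
Arguments codegen {c n} _.

Section Realization.
Variables (C : cosimplicial_cdgl) (L : cdgl).

Definition real_simp (n : nat) : Type := cdgl_hom (C n) L.

Definition real_face n (i : 'I_n.+2) (f : real_simp n.+1) : real_simp n :=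
  cdgl_comp f (coface i).

Definition real_degen n (i : 'I_n.+1) (f : real_simp n) : real_simp n.+1 :=
  cdgl_comp f (codegen i).

Lemma real_face_face n (i j : 'I_n.+2) (f : real_simp n.+2) : (i <= j)%N ->
  real_face i (real_face (up j) f) = real_face j (real_face (stay i) f).
Proof. by move=> ij; apply: cdgl_hom_ext => x /=; rewrite coface_coface. Qed.

Lemma real_degen_degen n (i j : 'I_n.+1) (f : real_simp n) : (i <= j)%N ->
  real_degen (stay i) (real_degen j f) = real_degen (up j) (real_degen i f).
Proof. by move=> ij; apply: cdgl_hom_ext => x /=; rewrite codegen_codegen. Qed.

Lemma real_face_degen_lt n (i : 'I_n.+2) (j : 'I_n.+1) (f : real_simp n.+1) :
  (i <= j)%N ->
  real_face (stay i) (real_degen (up j) f) = real_degen j (real_face i f).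
Proof. by move=> ij; apply: cdgl_hom_ext => x /=; rewrite codegen_coface_lt. Qed.

Lemma real_face_degen_id n (i : 'I_n.+2) (j : 'I_n.+1) (f : real_simp n) :
  i = j :> nat \/ i = j.+1 :> nat -> real_face i (real_degen j f) = f.
Proof. by move=> ij; apply: cdgl_hom_ext => x /=; rewrite codegen_coface_id. Qed.

Lemma real_face_degen_gt n (i : 'I_n.+2) (j : 'I_n.+1) (f : real_simp n.+1) :
  (j < i)%N ->
  real_face (up i) (real_degen (stay j) f) = real_degen j (real_face i f).
Proof. by move=> ij; apply: cdgl_hom_ext => x /=; rewrite codegen_coface_gt. Qed.

Definition realization : sset :=
  Sset real_face_face real_degen_degen real_face_degen_lt real_face_degen_id
    real_face_degen_gt.

End Realization.

(* The list of the first [n] coefficients of the power series t / (e^t - 1),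
   which is the inverse of \sum_k t^k / (k+1)! (see [toddE]). *)
Fixpoint todd_seq (n : nat) : seq rat :=
  if n is m.+1 then
    rcons (todd_seq m)
      ((m == 0%N)%:R - \sum_(k < m) (todd_seq m)`_k / ((m.+1 - k)`!)%:R)
  else [::].

Definition todd (n : nat) : rat := (todd_seq n.+1)`_n.

Lemma size_todd_seq n : size (todd_seq n) = n.
Proof. by elim: n => //= n IHn; rewrite size_rcons IHn. Qed.

Lemma nth_todd_seq n k : (k < n)%N -> (todd_seq n)`_k = todd k.
Proof.
elim: n => // n IHn; rewrite ltnS leq_eqVlt => /predU1P[-> //|kn].
by rewrite /= nth_rcons size_todd_seq kn IHn.
Qed.

Lemma toddE n :
  \sum_(k < n.+1) todd k / ((n.+1 - k)`!)%:R = (n == 0%N)%:R.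
Proof.
rewrite big_ord_recr /= subSnn divr1 {2}/todd /= nth_rcons size_todd_seq.
rewrite ltnn eqxx addrC; under [X in _ - X]eq_bigr do rewrite nth_todd_seq //.
exact: subrK.
Qed.

(* ad_x / (e^{ad_x} - 1) applied to y. *)
Definition todd_ad (L : cdgl) (x y : L) : L :=
  series_sum (fun k => todd k *: iter k (br x) y).

(* The vertex map of the codegeneracy sigma^i: values k <= i are kept, values
   k > i are decreased by 1. *)
Definition codegen_vertex n (i : 'I_n.+1) (k : 'I_n.+2) : 'I_n.+1 :=
  inord (unbump i k).

(* [C], with generators [a], is the cosimplicial cdgl of Buijs, Felix, Murillo
   and Tanre.  The generator a_{i_0...i_k} is [a n [set i_0; ...; i_k]], the
   strictly increasing sequences i_0 < ... < i_k in {0,...,n} being encoded as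
   the nonempty subsets of ['I_n.+1], so that the degree k - 1 is the
   cardinality minus 2; the value of [a n] on the empty set is irrelevant.
   [lift i] is the vertex map of the coface delta^i. *)
Record is_LL (C : cosimplicial_cdgl) (a : forall n, {set 'I_n.+1} -> C n) :
    Prop := {
  LL_free : forall n,
    is_free_complete
      (fun A : {A : {set 'I_n.+1} | A != finset.set0} => #|sval A|%:Z - 2)
      (fun A => a n (sval A));
  LL_vertex : forall n (r : 'I_n.+1), maurer_cartan (a n [set r]);
  LL_edge : forall n (r s : 'I_n.+1), (r < s)%N ->
    diff (a n [set r; s]) =
      br (a n [set r; s]) (a n [set s]) +
      todd_ad (a n [set r; s]) (a n [set s] - a n [set r]);
  LL_triangle : forall n (r s t : 'I_n.+1), (r < s < t)%N ->
    diff (a n [set r; s; t]) =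
      bch (bch (a n [set r; s]) (a n [set s; t])) (- a n [set r; t]) -
      br (a n [set r]) (a n [set r; s; t]);
  LL_coface : forall n (i : 'I_n.+2) (A : {set 'I_n.+1}), A != finset.set0 ->
    coface i (a n A) = a n.+1 (lift i @: A);
  LL_codegen : forall n (i : 'I_n.+1) (A : {set 'I_n.+2}), A != finset.set0 ->
    codegen i (a n.+1 A) =
      if (stay i \in A) && (up i \in A) then 0
      else a n (codegen_vertex i @: A)
}.

(* Main.v *)
Require Import Defs.
From HB Require Import structures.
From mathcomp Require Import all_boot all_order all_algebra.
From mathcomp Require Import ssrAC boolp classical_sets zify ring.

Set Implicit Arguments.
Unset Strict Implicit.
Unset Printing Implicit Defensive.

Import Order.TTheory GRing.Theory Num.Theory.
Local Open Scope ring_scope.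

(** Since [L] lies in degree 0, a morphism from [C n] to [L] kills all generators
    but the edges a_rs. Write x_rs for their images. Commutation with the
    differentials has content in degree 1 only, and there it may be tested on the
    triangles a_rst, for which it says that x_rs * x_st * x_rt^-1 is the unit. So
    an [n]-simplex of the realization is a family with x_rs * x_st = x_rt, that
    is, the tuple of its consecutive edges x_01, ..., x_(n-1)n ([edges_bij]);
    the effect of cofaces and codegeneracies on vertices turns into the faces and
    degeneracies of the bar construction ([edges_face], [edges_degen]).

    Two things have to be established for this. One is that a continuous morphism
    out of [C n] exists for any images of the generators of the right degrees
    ([free_complete_hom]) and is determined by them ([free_complete_ext]), and that
    it is a chain map as soon as it is one on generators ([hom_diff_eq0], through
    dual numbers).

    The other is that the Baker-Campbell-Hausdorff product is well defined and a
    group law ([bch_laws]). Let Z = log (e^X e^Y) and let D multiply each word by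
    its length. Differentiating e^Z = e^X e^Y along D gives
    (e^(ad Z) - 1) / ad Z (D Z) = X + e^(ad Z) Y, which expresses n Z_n through
    brackets of the Z_m with m < n; hence the Z_n are Lie polynomials
    ([bch_series_exists]). Identities pass from power series to [L] by a form of
    the Dynkin-Specht-Wever theorem ([lie_pair_filt]): the value in [L] of a Lie
    polynomial is determined by its expansion into words, because n times the value
    of its part of weight n is the image of a fixed vector under an action of the
    words. Associativity follows from that of e^X e^Y e^Z ([bch_assoc]), and the
    other group laws from the case of commuting elements ([bch_commute]). *)

(** * Noncommutative power series *)

(** Noncommutative formal power series; the alias carries the Cauchy product,
    not the pointwise one of functions. *)
Definition ser (I : Type) := seq I -> rat.

Section SeriesModule.
Variable I : Type.
Implicit Types f g h : ser I.

HB.instance Definition _ := gen_eqMixin (ser I).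
HB.instance Definition _ := gen_choiceMixin (ser I).

Let add f g : ser I := fun w => f w + g w.
Let opp f : ser I := fun w => - f w.
Let zero : ser I := fun _ => 0.

Let addA : associative add.
Proof. by move=> f g h; apply/funext => w; apply: addrA. Qed.
Let addC : commutative add.
Proof. by move=> f g; apply/funext => w; apply: addrC. Qed.
Let add0 : left_id zero add.
Proof. by move=> f; apply/funext => w; apply: add0r. Qed.
Let addN : left_inverse zero opp add.
Proof. by move=> f; apply/funext => w; apply: addNr. Qed.

HB.instance Definition _ := GRing.isZmodule.Build (ser I) addA addC add0 addN.

Let scale (c : rat) f : ser I := fun w => c * f w.

Let scaleA c d f : scale c (scale d f) = scale (c * d) f.
Proof. by apply/funext => w; apply: mulrA. Qed.
Let scale1 : left_id 1 scale.
Proof. by move=> f; apply/funext => w; apply: mul1r. Qed.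
Let scaleDr : right_distributive scale +%R.
Proof. by move=> c f g; apply/funext => w; apply: mulrDr. Qed.
Let scaleDl f : {morph scale^~ f : c d / c + d}.
Proof. by move=> c d; apply/funext => w; apply: mulrDl. Qed.

HB.instance Definition _ :=
  GRing.Zmodule_isLmodule.Build rat (ser I) scaleA scale1 scaleDr scaleDl.

Lemma serP f g : f =1 g <-> f = g.
Proof. by split=> [/funext|->]. Qed.

Lemma serDE f g w : (f + g) w = f w + g w. Proof. by []. Qed.
Lemma serNE f w : (- f) w = - f w. Proof. by []. Qed.
Lemma serBE f g w : (f - g) w = f w - g w. Proof. by []. Qed.
Lemma serZE c f w : (c *: f) w = c * f w. Proof. by []. Qed.
Lemma ser_sumE (J : Type) (r : seq J) (P : pred J) (F : J -> ser I) w :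
  (\sum_(j <- r | P j) F j) w = \sum_(j <- r | P j) F j w.
Proof. exact: (big_morph (fun f : ser I => f w)). Qed.

(** The left quotient by a letter lets products be computed by recursion on
    words, see [serM_cons] and [lquotM]. *)
Definition lquot (i : I) f : ser I := fun w => f (i :: w).

Lemma lquotD i f g : lquot i (f + g) = lquot i f + lquot i g.
Proof. by []. Qed.

Lemma lquotZ i c f : lquot i (c *: f) = c *: lquot i f.
Proof. by []. Qed.

Definition ser_mul f g : ser I := fun w =>
  \sum_(k < (size w).+1) f (take k w) * g (drop k w).

Lemma ser_mul_nil f g : ser_mul f g [::] = f [::] * g [::].
Proof. by rewrite /ser_mul big_ord1. Qed.

Lemma ser_mul_cons f g i w :
  ser_mul f g (i :: w) = f [::] * g (i :: w) + ser_mul (lquot i f) g w.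
Proof. by rewrite /ser_mul big_ord_recl. Qed.

Lemma ser_mulDl : left_distributive ser_mul +%R.
Proof.
move=> f g h; apply/serP => w; rewrite serDE /ser_mul -big_split /=.
by apply: eq_bigr => k _; apply: mulrDl.
Qed.

Lemma ser_mulDr : right_distributive ser_mul +%R.
Proof.
move=> f g h; apply/serP => w; rewrite serDE /ser_mul -big_split /=.
by apply: eq_bigr => k _; apply: mulrDr.
Qed.

Lemma ser_mulZl c f g : c *: ser_mul f g = ser_mul (c *: f) g.
Proof.
apply/serP => w; rewrite serZE /ser_mul mulr_sumr.
by apply: eq_bigr => k _; apply: mulrA.
Qed.

Lemma ser_mulZr c f g : c *: ser_mul f g = ser_mul f (c *: g).
Proof.
apply/serP => w; rewrite serZE /ser_mul mulr_sumr.
by apply: eq_bigr => k _; apply: mulrCA.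
Qed.

Lemma ser_lquot_mul i f g : lquot i (ser_mul f g) = f [::] *: lquot i g + ser_mul (lquot i f) g.
Proof. by apply/serP => w; rewrite /lquot ser_mul_cons. Qed.

Lemma ser_mulA : associative ser_mul.
Proof.
move=> f g h; apply/serP => w.
elim: w f g h => [|i w IHw] f g h; first by rewrite !ser_mul_nil mulrA.
rewrite !ser_mul_cons ser_mul_nil ser_lquot_mul ser_mulDl serDE -ser_mulZl serZE IHw.
by rewrite mulrDr !addrA mulrA.
Qed.

Definition ser_one : ser I := fun w => (nilp w)%:R.

Lemma ser_mul1l : left_id ser_one ser_mul.
Proof.
move=> f; apply/serP => w; rewrite /ser_mul big_ord_recl take0 drop0 mul1r.
rewrite big1 ?addr0 // => k _.
by case: w k => [|i w] k; [case: k|rewrite /ser_one /= mul0r].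
Qed.

Lemma ser_mul1r : right_id ser_one ser_mul.
Proof.
move=> f; apply/serP => w; elim: w f => [|i w IHw] f.
  by rewrite ser_mul_nil mulr1.
by rewrite ser_mul_cons mulr0 add0r IHw.
Qed.

Lemma ser_one_neq0 : ser_one != 0.
Proof. by apply/eqP => /serP/(_ [::])/eqP; rewrite oner_eq0. Qed.

HB.instance Definition _ :=
  GRing.Zmodule_isNzRing.Build (ser I)
    ser_mulA ser_mul1l ser_mul1r ser_mulDl ser_mulDr ser_one_neq0.
HB.instance Definition _ := GRing.Lmodule_isLalgebra.Build rat (ser I) ser_mulZl.
HB.instance Definition _ := GRing.Lalgebra_isAlgebra.Build rat (ser I) ser_mulZr.

Lemma serME f g w : (f * g) w = \sum_(k < (size w).+1) f (take k w) * g (drop k w).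
Proof. by []. Qed.
Lemma ser1E w : (1 : ser I) w = (nilp w)%:R.
Proof. by []. Qed.
Lemma serM_nil f g : (f * g) [::] = f [::] * g [::].
Proof. exact: ser_mul_nil. Qed.
Lemma serM_cons f g i w :
  (f * g) (i :: w) = f [::] * g (i :: w) + (lquot i f * g) w.
Proof. exact: ser_mul_cons. Qed.
Lemma lquotM i f g : lquot i (f * g) = f [::] *: lquot i g + lquot i f * g.
Proof. exact: ser_lquot_mul. Qed.

End SeriesModule.

Definition var (I : eqType) (i : I) : ser I := fun w => (w == [:: i])%:R.

Section Vanishing.
Variable I : Type.
Implicit Types f g h : ser I.

Definition vanish n f := forall w, (size w < n)%N -> f w = 0.

Lemma vanish0 n : vanish n 0. Proof. by []. Qed.

Lemma vanishD n f g : vanish n f -> vanish n g -> vanish n (f + g).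
Proof. by move=> f0 g0 w wn; rewrite serDE f0 // g0 // addr0. Qed.

Lemma vanishZ n c f : vanish n f -> vanish n (c *: f).
Proof. by move=> f0 w wn; rewrite serZE f0 // mulr0. Qed.

Lemma vanishN n f : vanish n f -> vanish n (- f).
Proof. by move=> f0 w wn; rewrite serNE f0 // oppr0. Qed.

Lemma vanishB n f g : vanish n f -> vanish n g -> vanish n (f - g).
Proof. by move=> f0 g0; apply: vanishD => //; apply: vanishN. Qed.

Lemma vanish_sum n (J : Type) (r : seq J) (P : pred J) (F : J -> ser I) :
  (forall j, P j -> vanish n (F j)) -> vanish n (\sum_(j <- r | P j) F j).
Proof. by move=> F0; elim/big_rec: _ => // j f Pj; apply/vanishD/F0. Qed.

Lemma vanishM m n f g : vanish m f -> vanish n g -> vanish (m + n) (f * g).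
Proof.
move=> f0 g0 w wmn; rewrite serME big1 // => -[k /= kw] _.
have [km|mk] := ltnP k m; first by rewrite f0 ?mul0r // size_take_min; lia.
by rewrite g0 ?mulr0 // size_drop; lia.
Qed.

Lemma vanish_le m n f : (m <= n)%N -> vanish n f -> vanish m f.
Proof. by move=> mn f0 w wm; apply/f0/(leq_trans wm). Qed.

Lemma vanishX f n : vanish 1 f -> vanish n (f ^+ n).
Proof. by move=> f0; elim: n => // n IHn; rewrite exprS -add1n; apply: vanishM. Qed.

Lemma vanish1P f : f [::] = 0 <-> vanish 1 f.
Proof. by split=> [f0 [] //|->]. Qed.

Lemma vanish_eq0 f : (forall n, vanish n f) -> f = 0.
Proof. by move=> f0; apply/serP => w; apply: (f0 (size w).+1). Qed.

(** A nonzero series of order [n] keeps its part of degree [n] when multiplied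
    by a series of constant term 1. *)
Lemma mul_eq0_unit f g : g [::] = 1 -> f * g = 0 -> f = 0.
Proof.
move=> g1 fg0; apply: vanish_eq0; elim=> // n IHn w; rewrite ltnS leq_eqVlt.
case/predU1P=> [wn|/IHn//].
have /serP/(_ w) := fg0; rewrite serME big_ord_recr /= take_size drop_size g1 mulr1.
rewrite big1 ?add0r // => -[k kw] _ /=; rewrite IHn ?mul0r // size_take_min; lia.
Qed.

End Vanishing.

Lemma sum_triangle (V : nmodType) (K : nat) (F : nat -> nat -> V) :
    (forall k l, (K <= k + l)%N -> F k l = 0) ->
  \sum_(k < K) \sum_(l < K) F k l =
  \sum_(n < K) \sum_(k < n.+1) F k (n - k)%N.
Proof.
move=> F0.
transitivity (\sum_(k < K) \sum_(n < K | (k <= n)%N) F k (n - k)%N).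
  apply: eq_bigr => -[k kK] _ /=.
  rewrite -(big_mkord xpredT (F k)) (@big_cat_nat _ _ _ (K - k)%N) ?leq_subr //=.
  rewrite [X in _ + X]big_nat_cond [X in _ + X]big1 ?addr0; last first.
    by move=> l; rewrite andbT => ?; apply: F0; lia.
  rewrite -(big_mkord (fun n => k <= n)%N (fun n => F k (n - k)%N)).
  rewrite [RHS](@big_cat_nat _ _ _ k) //=; last lia.
  rewrite [X in _ = X + _]big_nat_cond [X in _ = X + _]big_pred0; last first.
    by move=> l; lia.
  have shift := big_addn 0 K k; rewrite add0n in shift.
  rewrite add0r shift big_nat_cond [RHS]big_nat_cond.
  apply: eq_big => l; first by lia.
  by rewrite addnK.
rewrite (exchange_big_dep xpredT) //=; apply: eq_bigr => -[n nK] _ /=.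
rewrite -(big_mkord (fun k => k <= n)%N (fun k => F k (n - k)%N)).
rewrite -(big_mkord xpredT (fun k => F k (n - k)%N)).
by rewrite [RHS](big_nat_widen _ _ K).
Qed.

Lemma sum_trunc (V : nmodType) (m n : nat) (F : nat -> V) :
  (m <= n)%N -> (forall k, (m <= k < n)%N -> F k = 0) ->
  \sum_(k < n) F k = \sum_(k < m) F k.
Proof.
move=> mn F0; rewrite -!(big_mkord xpredT) (@big_cat_nat _ _ _ m) //=.
by rewrite [X in _ + X]big_nat_cond [X in _ + X]big1 ?addr0 // => k /andP[/F0].
Qed.

Section Sums.
Variable I : Type.
Implicit Types (f g : ser I) (F G : nat -> ser I).

Definition summable F := forall n, vanish n (F n).

(** The bound loses nothing when [F] is [summable], and makes each coefficient
    a finite sum in all cases. *)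
Definition ssum F : ser I := fun w => \sum_(n < (size w).+1) F n w.

Lemma ssumE F N w : summable F -> (size w < N)%N -> ssum F w = (\sum_(n < N) F n) w.
Proof.
move=> F0 wN; rewrite ser_sumE /ssum; symmetry; apply: (@sum_trunc _ _ _ (fun k => F k w)) => //.
by move=> k /andP[wk _]; apply: F0.
Qed.

Lemma ssum_trunc F N : summable F -> vanish N (ssum F - \sum_(n < N) F n).
Proof. by move=> F0 w wN; rewrite serBE -ssumE // subrr. Qed.

Lemma eq_ssum F G : F =1 G -> ssum F = ssum G.
Proof. by move=> FG; apply/serP => w; apply: eq_bigr => n _; rewrite FG. Qed.

Lemma ssumD F G : ssum (fun n => F n + G n) = ssum F + ssum G.
Proof. by apply/serP => w; rewrite serDE /ssum -big_split. Qed.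

Lemma ssumB F G : ssum (fun n => F n - G n) = ssum F - ssum G.
Proof. by apply/serP => w; rewrite serBE /ssum -sumrB. Qed.

Lemma ssumZ c F : ssum (fun n => c *: F n) = c *: ssum F.
Proof. by apply/serP => w; rewrite serZE /ssum mulr_sumr. Qed.

Lemma ssum_recl F : F 0%N = 0 -> summable F -> ssum F = ssum (fun n => F n.+1).
Proof.
move=> F0 sF; apply/serP => w.
rewrite (@ssumE _ (size w).+2 _ sF) // ser_sumE big_ord_recl F0 add0r.
by [].
Qed.

Lemma ssum_split F : ssum F = F 0%N + ssum (fun n => if n is m.+1 then F n else 0).
Proof.
by apply/serP => w; rewrite serDE /ssum !big_ord_recl add0r.
Qed.

Lemma ssumM F G : summable F -> summable G ->
  ssum F * ssum G = ssum (fun n => \sum_(k < n.+1) F k * G (n - k)%N).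
Proof.
move=> sF sG; apply/serP => w; set N := (size w).+1.
have eqmod (f f' g g' : ser I) : vanish N (f - f') -> vanish N (g - g') ->
    (f * g) w = (f' * g') w.
  move=> ff' gg'; apply/eqP; rewrite -subr_eq0 -serBE.
  have -> : f * g - f' * g' = (f - f') * g + f' * (g - g').
    by rewrite mulrBl mulrBr addrA subrK.
  rewrite serDE; have v0 (h : ser I) : vanish 0 h by [].
  rewrite (vanishM ff' (v0 g)) ?addn0 // (vanishM (v0 f') gg') ?addr0 //.
rewrite (eqmod _ _ _ _ (ssum_trunc (N := N) sF) (ssum_trunc (N := N) sG)).
rewrite mulr_suml ser_sumE.
under eq_bigr do rewrite mulr_sumr ser_sumE.
rewrite (@sum_triangle _ N (fun k l => (F k * G l) w)); last first.
  by move=> k l Nkl; apply: (vanishM (sF k) (sG l)).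
by apply: eq_bigr => n _; rewrite ser_sumE.
Qed.

End Sums.

(** * Series acting on modules, and substitution *)

Section Action.
Variables (I : finType) (M : lmodType rat) (A : I -> {linear M -> M}).
Implicit Types (f g : ser I) (y z : M).

(** The operator obtained from the part of degree [n] of [f] when the letters
    act on [M] through [A]. It serves twice: with [A] a family of left
    multiplications it gives substitution, and with [A] operators attached to
    elements of a Lie algebra it gives the Dynkin map. *)
Fixpoint act n f y : M :=
  if n is m.+1 then \sum_i A i (act m (lquot i f) y) else f [::] *: y.

Lemma actS n f y : act n.+1 f y = \sum_i A i (act n (lquot i f) y).
Proof. by []. Qed.

Lemma act_is_linear n f : linear (act n f).
Proof.
elim: n f => [|n IHn] f c y z /=; first by rewrite scalerDr !scalerA mulrC.
rewrite scaler_sumr -big_split; apply: eq_bigr => i _.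
by rewrite IHn linearP.
Qed.

HB.instance Definition _ n f :=
  GRing.isLinear.Build rat M M _ (act n f) (act_is_linear n f).

Lemma actP n c f g y : act n (c *: f + g) y = c *: act n f y + act n g y.
Proof.
elim: n f g => [|n IHn] f g /=; first by rewrite scalerDl scalerA.
rewrite scaler_sumr -big_split; apply: eq_bigr => i _.
by rewrite lquotD lquotZ IHn linearP.
Qed.

Lemma act0 n y : act n 0 y = 0.
Proof. by have := actP n (-1) 0 0 y; rewrite scaler0 addr0 scaleN1r addNr. Qed.

Lemma actD n f g y : act n (f + g) y = act n f y + act n g y.
Proof. by rewrite -[f]scale1r actP !scale1r. Qed.

Lemma actZ n c f y : act n (c *: f) y = c *: act n f y.
Proof. by rewrite -[c *: f]addr0 actP act0 addr0. Qed.

Lemma actB n f g y : act n (f - g) y = act n f y - act n g y.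
Proof. by rewrite -[in LHS]scaleN1r actD actZ scaleN1r. Qed.

Lemma eq_act n f g y : (forall w, size w = n -> f w = g w) -> act n f y = act n g y.
Proof.
elim: n f g => [|n IHn] f g fg /=; first by rewrite fg.
by apply: eq_bigr => i _; congr (A i _); apply: IHn => w wn; rewrite /lquot fg //= wn.
Qed.

Lemma act_vanish n m f y : vanish m f -> (n < m)%N -> act n f y = 0.
Proof. by move=> f0 nm; rewrite -(act0 n y); apply: eq_act => w wn; rewrite f0 ?wn. Qed.

Lemma act1 n y : act n 1 y = if n == 0%N then y else 0.
Proof.
case: n => [|n] /=; first by rewrite ser1E scale1r.
by rewrite big1 // => i _; rewrite (_ : lquot i 1 = 0) ?act0 ?linear0.
Qed.

Lemma actX n i y : act n (var i) y = if n == 1%N then A i y else 0.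
Proof.
case: n => [|n] /=; first by rewrite /var /= scale0r.
have lq j : lquot j (var i) = if j == i then 1 else 0.
  apply/serP => w; rewrite /lquot /var eqseq_cons.
  by case: eqP => _ //=; rewrite ser1E; case: w.
rewrite (bigD1 i) //= lq eqxx big1 ?addr0 => [|j /negPf ji]; last first.
  by rewrite lq ji act0 linear0.
by rewrite act1 eqSS; case: eqP => // _; rewrite linear0.
Qed.

(** [act] is the representation of the algebra of series extending [A]. *)
Lemma actM n f g y :
  act n (f * g) y = \sum_(k < n.+1) act k f (act (n - k) g y).
Proof.
elim: n f g => [|n IHn] f g; first by rewrite big_ord1 /= serM_nil scalerA.
rewrite big_ord_recl /= scaler_sumr exchange_big -big_split /=.
apply: eq_bigr => i _; rewrite lquotM actD actZ linearD linearZ.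
by congr (_ + _); rewrite IHn linear_sum.
Qed.

End Action.

Definition lmul (J : Type) (u x : ser J) : ser J := u * x.

HB.instance Definition _ (J : Type) (u : ser J) :=
  GRing.isLinear.Build rat (ser J) (ser J) _ (lmul u)
    (fun c x y => etrans (mulrDr u (c *: x) y)
                   (congr1 (+%R^~ (u * y)) (esym (scalerAr c u x)))).

(** The part of degree [n] of [f], evaluated at [u]. *)
Definition subst_term (I : finType) (J : Type) (u : I -> ser J) n (f : ser I) : ser J :=
  act (fun i => lmul (u i)) n f 1.

Definition subst (I : finType) (J : Type) (u : I -> ser J) (f : ser I) : ser J :=
  ssum (fun n => subst_term u n f).

Section Substitution.
Variables (I : finType) (J : Type) (u : I -> ser J).
Hypothesis u0 : forall i, vanish 1 (u i).
Implicit Types (f g : ser I) (F : nat -> ser I).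

Lemma act_lmul n f y : act (fun i => lmul (u i)) n f y = subst_term u n f * y.
Proof.
rewrite /subst_term; elim: n f y => [|n IHn] f y /=; first by rewrite -scalerAl mul1r.
by rewrite mulr_suml; apply: eq_bigr => i _; rewrite IHn /lmul /= mulrA.
Qed.

Lemma subst_term_vanish n f : vanish n (subst_term u n f).
Proof.
rewrite /subst_term; elim: n f => [//|n IHn] f /=.
by apply: vanish_sum => i _; rewrite -add1n; apply: vanishM.
Qed.

Lemma subst_summable f : summable (fun n => subst_term u n f).
Proof. by move=> n; apply: subst_term_vanish. Qed.

Lemma substD f g : subst u (f + g) = subst u f + subst u g.
Proof. by rewrite /subst -ssumD; apply: eq_ssum => n; apply: actD. Qed.

Lemma substZ c f : subst u (c *: f) = c *: subst u f.
Proof. by rewrite /subst -ssumZ; apply: eq_ssum => n; apply: actZ. Qed.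

Lemma substN f : subst u (- f) = - subst u f.
Proof. by rewrite -!scaleN1r substZ. Qed.

Lemma substB f g : subst u (f - g) = subst u f - subst u g.
Proof. by rewrite substD substN. Qed.

Lemma subst0 : subst u 0 = 0.
Proof. by rewrite -(scale0r (0 : ser I)) substZ scale0r. Qed.

Lemma subst_sum (K : Type) (r : seq K) (P : pred K) (F : K -> ser I) :
  subst u (\sum_(j <- r | P j) F j) = \sum_(j <- r | P j) subst u (F j).
Proof. exact: (big_morph (subst u) substD subst0). Qed.

Lemma subst1 : subst u 1 = 1.
Proof.
apply/serP => w; rewrite /subst /ssum big_ord_recl /subst_term act1 big1 ?addr0 // => n _.
by rewrite act1.
Qed.

Lemma substX i : subst u (var i) = u i.
Proof.
apply/serP => w; rewrite /subst (ssumE (N := (size w).+2) (subst_summable (var i))) //.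
rewrite !big_ord_recl /subst_term !actX /= /lmul mulr1 add0r big1 ?addr0 // => n _.
exact: (actX (fun i => lmul (u i)) n.+2 i 1).
Qed.

Lemma substM f g : subst u (f * g) = subst u f * subst u g.
Proof.
rewrite /subst ssumM; [|exact: subst_summable..]; apply: eq_ssum => n.
by rewrite /subst_term actM; apply: eq_bigr => k _; rewrite act_lmul.
Qed.

Lemma subst_exp f n : subst u (f ^+ n) = subst u f ^+ n.
Proof. by elim: n => [|n IHn]; rewrite ?subst1 // !exprS substM IHn. Qed.

Lemma subst_vanish N f : vanish N f -> vanish N (subst u f).
Proof.
move=> f0 w wN; rewrite /subst /ssum big1 // => -[n nw] _ /=.
by rewrite /subst_term (act_vanish _ _ f0) //; lia.
Qed.

Lemma subst_ssum F : summable F -> subst u (ssum F) = ssum (fun n => subst u (F n)).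
Proof.
move=> sF; apply/serP => w; set N := (size w).+1.
have v := subst_vanish (ssum_trunc (N := N) sF).
have := v w (leqnn _); rewrite substB subst_sum serBE => /eqP; rewrite subr_eq0 => /eqP->.
by rewrite (@ssumE _ _ N) // => n; apply/subst_vanish/sF.
Qed.

End Substitution.

Lemma subst_cong (I : finType) (J : Type) (u v : I -> ser J) N (f : ser I) :
    (forall i, vanish 1 (u i)) -> (forall i, vanish 1 (v i)) ->
  (forall i, vanish N (u i - v i)) -> vanish N (subst u f - subst v f).
Proof.
move=> u0 v0 uv; rewrite -ssumB => w wN; rewrite /ssum big1 // => -[n _] _ /=.
suff /(_ w wN) : vanish N (subst_term u n f - subst_term v n f) by [].
rewrite /subst_term; elim: n f {w wN} => [|n IHn] f /=; first by rewrite subrr.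
rewrite -sumrB; apply: vanish_sum => i _; rewrite /lmul.
set a := act _ _ _ _; set b := act _ _ _ _.
have -> : u i * a - v i * b = (u i - v i) * a + v i * (a - b).
  by rewrite mulrBl mulrBr addrA subrK.
apply: vanishD; first by rewrite -[N]addn0; apply: vanishM.
by rewrite -[N]add0n; apply: vanishM => //; apply: IHn.
Qed.

(** * Exponential and logarithm *)

Section Exponential.
Variable I : Type.
Implicit Types (f g Z B : ser I) (F : nat -> ser I).

Lemma ssum_mull F B : summable F -> ssum F * B = ssum (fun n => F n * B).
Proof.
move=> sF; apply/serP => w; set N := (size w).+1.
have sFB : summable (fun n => F n * B).
  by move=> n; have := @vanishM _ n 0 _ B (sF n); rewrite addn0; apply.
rewrite (@ssumE _ _ N) // -mulr_suml.
apply/eqP; rewrite -subr_eq0 -serBE -mulrBl.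
by apply/eqP; apply: (@vanishM _ N 0); rewrite ?addn0 //; apply: ssum_trunc.
Qed.

Definition ser_exp f : ser I := ssum (fun n => (n`!)%:R^-1 *: f ^+ n).

Lemma summable_exp f : vanish 1 f -> summable (fun n => (n`!)%:R^-1 *: f ^+ n).
Proof. by move=> f0 n; apply/vanishZ/vanishX. Qed.

Lemma ser_exp_nil f : ser_exp f [::] = 1.
Proof. by rewrite /ser_exp /ssum big_ord1 serZE expr0 ser1E mulr1 invr1. Qed.

Definition ad Z B : ser I := Z * B - B * Z.

Lemma vanish_ad m n f g : vanish m f -> vanish n g -> vanish (m + n) (ad f g).
Proof. by move=> f0 g0; apply: vanishB; [|rewrite addnC]; apply: vanishM. Qed.

Lemma summable_ad Z B : vanish 1 Z -> summable (fun k => iter k (ad Z) B).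
Proof. by move=> Z0; elim=> // k IHk; rewrite iterS -add1n; apply: vanish_ad. Qed.

Lemma mul_ad Z B : Z * B = ad Z B + B * Z.
Proof. by rewrite subrK. Qed.

(** Left multiplication by [Z] is the sum of the commuting operators [ad Z] and
    right multiplication by [Z], so this is the binomial formula. *)
Lemma expr_mul_ad Z B n :
  Z ^+ n * B = \sum_(k < n.+1) iter k (ad Z) B * Z ^+ (n - k) *+ 'C(n, k).
Proof.
elim: n => [|n IHn]; first by rewrite big_ord1 /= mul1r mulr1.
rewrite exprS -mulrA IHn mulr_sumr [in RHS]big_ord_recl bin0 mulr1n subn0.
under [in RHS]eq_bigr do rewrite lift0 subSS binS mulrnDr iterS.
rewrite [in RHS]big_split /=.
under [in LHS]eq_bigr => k _.
  rewrite mulrnAr mulrA (mul_ad Z) mulrDl mulrnDl -mulrA -exprS -subSn; last by case: k.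
  over.
rewrite big_split /= addrC addrA; congr (_ + _).
rewrite big_ord_recl bin0 mulr1n subn0; congr (_ + _).
rewrite [RHS]big_ord_recr [RHS]/= bin_small // mulr0n addr0.
by apply: eq_bigr => k _; rewrite lift0 subSS.
Qed.

Lemma invf_fact_bin n k : (k <= n)%N ->
  (n`!)%:R^-1 * ('C(n, k))%:R = (k`!)%:R^-1 * ((n - k)`!)%:R^-1 :> rat.
Proof.
move=> kn; have := bin_fact kn => /(congr1 (fun m => m%:R : rat)).
rewrite !natrM => <-; have nz m : (m`!)%:R != 0 :> rat by rewrite pnatr_eq0 -lt0n fact_gt0.
have cz : ('C(n, k))%:R != 0 :> rat by rewrite pnatr_eq0 -lt0n bin_gt0.
by field; rewrite !nz cz.
Qed.

(** Conjugation by e^Z is the exponential of [ad Z]. *)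
Lemma exp_mul_ad Z B : vanish 1 Z ->
  ser_exp Z * B = ssum (fun k => (k`!)%:R^-1 *: iter k (ad Z) B) * ser_exp Z.
Proof.
move=> Z0; have sZ := summable_exp Z0; have sA := summable_ad B Z0.
rewrite /ser_exp ssum_mull // ssumM //; last by move=> k; apply/vanishZ/sA.
apply: eq_ssum => n; rewrite -scalerAl expr_mul_ad scaler_sumr.
apply: eq_bigr => -[k /= kn] _; rewrite -scaler_nat scalerA invf_fact_bin //.
by rewrite -scalerA -scalerAr -scalerAl scalerA mulrC -scalerA.
Qed.

(** The derivation that multiplies a homogeneous series by its degree; it plays
    the part of d/dt for the path obtained by scaling the letters by [t]. *)
Definition euler f : ser I := fun w => (size w)%:R * f w.

Lemma eulerZ c f : euler (c *: f) = c *: euler f.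
Proof. by apply/serP => w; apply: mulrCA. Qed.

Lemma euler1 : euler 1 = 0.
Proof. by apply/serP => -[|i w]; rewrite /euler ser1E ?mul0r ?mulr0. Qed.

Lemma vanish_euler n f : vanish n f -> vanish n (euler f).
Proof. by move=> f0 w wn; rewrite /euler f0 // mulr0. Qed.

Lemma vanish1_euler f : vanish 1 (euler f).
Proof. by apply/vanish1P; rewrite /euler mul0r. Qed.

Lemma eulerM f g : euler (f * g) = euler f * g + f * euler g.
Proof.
apply/serP => w; rewrite serDE /euler !serME mulr_sumr -big_split.
apply: eq_bigr => -[k /= kw] _; rewrite size_takel // size_drop.
have -> : (size w)%:R = k%:R + (size w - k)%:R :> rat by rewrite -natrD subnKC.
by ring.
Qed.

Lemma euler_ssum F : euler (ssum F) = ssum (fun n => euler (F n)).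
Proof. by apply/serP => w; rewrite /euler /ssum mulr_sumr. Qed.

Lemma euler_expr Z n :
  euler (Z ^+ n.+1) =
  \sum_(k < n.+1) iter k (ad Z) (euler Z) * Z ^+ (n - k) *+ 'C(n.+1, k.+1).
Proof.
elim: n => [|n IHn]; first by rewrite big_ord1 expr1 mulr1.
rewrite exprS eulerM IHn mulr_sumr.
under [RHS]eq_bigr do rewrite binS mulrnDr.
rewrite [RHS]big_split /= [RHS]addrC.
rewrite [X in _ = X + _]big_ord_recl bin0 subn0 mulr1n -addrA.
congr (_ + _).
under eq_bigr => k _.
  rewrite mulrnAr mulrA (mul_ad Z) mulrDl mulrnDl -mulrA -exprS -subSn; last by case: k.
  over.
rewrite big_split; congr (_ + _) => /=.
by rewrite [RHS]big_ord_recr /= bin_small // mulr0n addr0.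
Qed.

(** The differential of the exponential along [euler]:
    D (e^Z) e^(-Z) is the value at D Z of (e^(ad Z) - 1) / ad Z. *)
Lemma euler_exp Z : vanish 1 Z ->
  euler (ser_exp Z) =
  ssum (fun k => (k.+1`!)%:R^-1 *: iter k (ad Z) (euler Z)) * ser_exp Z.
Proof.
move=> Z0; have sZ := summable_exp Z0; have sA := summable_ad (euler Z) Z0.
rewrite /ser_exp ssumM //; last by move=> k; apply/vanishZ/sA.
rewrite euler_ssum ssum_recl ?eulerZ ?euler1 ?scaler0 //; last first.
  by move=> n; apply/vanish_euler/sZ.
apply: eq_ssum => n; rewrite eulerZ euler_expr scaler_sumr.
apply: eq_bigr => -[k /= kn] _; rewrite -scaler_nat scalerA invf_fact_bin // subSS.
by rewrite -scalerA -scalerAr -scalerAl scalerA mulrC -scalerA.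
Qed.

Lemma vanish_subX f g n k : vanish 1 f -> vanish 1 g -> vanish n (f - g) ->
  vanish (n + k) (f ^+ k.+1 - g ^+ k.+1).
Proof.
move=> f0 g0 fg; elim: k => [|k IHk]; first by rewrite addn0.
have -> : f ^+ k.+2 - g ^+ k.+2 = (f - g) * f ^+ k.+1 + g * (f ^+ k.+1 - g ^+ k.+1).
  by rewrite mulrBl mulrBr addrA -!exprS subrK.
apply: vanishD; first by apply: vanishM => //; apply: vanishX.
by rewrite addnS -add1n; apply: vanishM.
Qed.

(** In its lowest degree e^f - e^g is f - g, the differences of higher powers
    starting at least one degree later ([vanish_subX]). *)
Lemma ser_exp_inj f g : vanish 1 f -> vanish 1 g -> ser_exp f = ser_exp g -> f = g.
Proof.
move=> f0 g0 efg; apply/subr0_eq/vanish_eq0; elim=> // n IHn.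
have {efg} : ser_exp f - ser_exp g = 0 by rewrite efg subrr.
rewrite -ssumB => /serP efg w wn; have := efg w.
rewrite (@ssumE _ _ (size w).+2) // => [|k]; last first.
  by apply: vanishB; apply: summable_exp.
rewrite big_ord_recl !expr0 subrr add0r big_ord_recl serDE !lift0 !expr1 invr1 !scale1r.
rewrite ser_sumE big1 ?addr0 // => -[k kw] _; rewrite !lift0 -scalerBr.
apply: (@vanishZ _ n.+1) wn; apply: (@vanish_le _ n.+1 (n + k.+1)); first by lia.
exact: vanish_subX.
Qed.

Definition ser_log f : ser I :=
  ssum (fun n => if n is m.+1 then ((-1) ^+ m / n%:R) *: (f - 1) ^+ n else 0).

End Exponential.

Section Logarithm.

Let t : ser unit := var tt.

(** Words in one letter are determined by their length. *)
Lemma ser_unit_mulC (f g : ser unit) : f * g = g * f.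
Proof.
apply/serP => w; rewrite !serME (reindex_inj rev_ord_inj) /=.
apply: eq_bigr => -[k /= kw] _; rewrite mulrC subSS.
have wE : w = nseq (size w) tt by elim: w {kw} => //= -[] w ->; rewrite size_nseq.
have unitE (u v : seq unit) : size u = size v -> u = v.
  by elim: u v => [|[] u IHu] [|[] v] //= [] /IHu ->.
congr (g _ * f _); apply: unitE.
  by rewrite size_drop size_takel // subKn.
by rewrite size_takel ?size_drop ?leq_subr.
Qed.

(** The series log (1 + t). *)
Let ell : ser unit := fun w =>
  if w is _ :: v then (-1) ^+ size v / (size w)%:R else 0.

Let t_nil (f : ser unit) : (t * f) [::] = 0.
Proof. by rewrite serM_nil mul0r. Qed.

Let t_cons (f : ser unit) w : (t * f) (tt :: w) = f w.
Proof.
rewrite serM_cons mul0r add0r (_ : lquot tt t = 1) ?mul1r //.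
by apply/serP => -[].
Qed.

Let ellE : (1 + t) * euler ell = t.
Proof.
apply/serP => -[|[] w]; rewrite mulrDl mul1r serDE ?t_nil ?t_cons.
  by rewrite /euler /= mul0r.
rewrite /euler /= [_%:R * _]mulrCA divff ?pnatr_eq0 // mulr1.
case: w => [|[] w] /=; first by rewrite mul0r addr0.
by rewrite [_%:R * _]mulrCA divff ?pnatr_eq0 // mulr1 exprS mulN1r addNr.
Qed.

Let ell0 : vanish 1 ell. Proof. by apply/vanish1P. Qed.

Let exp_ell : ser_exp ell = 1 + t.
Proof.
set W := ser_exp ell.
have EW : euler W = euler ell * W.
  rewrite /W euler_exp // ssum_split /= invr1 scale1r.
  have ad0 k : ad ell (iter k (ad ell) (euler ell)) = 0 by rewrite /ad ser_unit_mulC subrr.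
  rewrite (_ : ssum _ = 0) ?addr0 //; apply/serP => w; rewrite /ssum big1 // => -[[|k] kw] _ //=.
  by rewrite ad0 scaler0.
(* Coefficientwise this differential equation reads
   (n + 1) w_(n+1) = (1 - n) w_n: it stops after w_1 = w_0. *)
have {EW} EW : (1 + t) * euler W = t * W by rewrite EW mulrA ellE.
have W0 : W [::] = 1 by apply: ser_exp_nil.
have Wrec w : ((size w).+1)%:R * W (tt :: w) = (1 - (size w)%:R) * W w.
  have /serP/(_ (tt :: w)) := EW; rewrite mulrDl mul1r serDE !t_cons /euler /= => EWw.
  by rewrite mulrBl mul1r -{1}EWw addrK.
have W1 : W [:: tt] = 1 by have := Wrec [::]; rewrite /= mulr0n subr0 !mul1r W0.
have W2 w : W [:: tt, tt & w] = 0.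
  elim: w => [|[] w IHw].
    have := Wrec [:: tt]; rewrite /= subrr mul0r => /eqP.
    by rewrite mulf_eq0 pnatr_eq0 => /eqP.
  have := Wrec [:: tt, tt & w]; rewrite IHw mulr0 => /eqP.
  by rewrite mulf_eq0 pnatr_eq0 => /eqP.
apply/serP => -[|[] [|[] w]]; rewrite serDE ser1E /t /var /=.
- by rewrite W0 addr0.
- by rewrite W1 add0r.
- by rewrite W2 addr0.
Qed.

(** The identity exp (log (1 + t)) = 1 + t in one letter, [exp_ell], in which
    [f - 1] is substituted for [t]. *)
Lemma ser_exp_log (I : Type) (f : ser I) : f [::] = 1 ->
  vanish 1 (ser_log f) /\ ser_exp (ser_log f) = f.
Proof.
move=> f1; pose u (_ : unit) := f - 1.
have u0 i : vanish 1 (u i) by apply/vanish1P; rewrite /u serBE f1 subrr.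
have logE : ser_log f = subst u ell.
  apply: eq_ssum => n.
  have termE m (g : ser unit) : subst_term u m g = g (nseq m tt) *: (f - 1) ^+ m.
    rewrite /subst_term; elim: m g => [|m IHm] g //=.
    rewrite (bigD1 tt) //= big1 ?addr0; last by case.
    by rewrite IHm /lmul -scalerAr -exprS.
  by rewrite termE; case: n => [|n] /=; rewrite ?scale0r // size_nseq.
rewrite logE; split; first exact: subst_vanish.
transitivity (subst u (ser_exp ell)).
  rewrite /ser_exp subst_ssum //; last exact: summable_exp.
  by apply: eq_ssum => n; rewrite substZ subst_exp.
by rewrite exp_ell substD subst1 substX // addrC subrK.
Qed.

End Logarithm.

Lemma subst_ser_exp (I : finType) (J : Type) (u : I -> ser J) (f : ser I) :
    (forall i, vanish 1 (u i)) -> vanish 1 f ->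
  subst u (ser_exp f) = ser_exp (subst u f).
Proof.
move=> u0 f0; rewrite /ser_exp subst_ssum //; last exact: summable_exp.
by apply: eq_ssum => n; rewrite substZ subst_exp.
Qed.

Lemma nc_powE f n : nc_pow f n = (f : ser bool) ^+ n.
Proof.
elim: n => [|n IHn]; first by apply/serP => -[].
by rewrite exprS -IHn.
Qed.

Lemma nc_expE f : nc_exp f = ser_exp (f : ser bool).
Proof.
by apply/serP => w; apply: eq_bigr => n _; rewrite nc_powE.
Qed.

Lemma nc_logE f : nc_log f = ser_log (f : ser bool).
Proof.
apply/serP => w; rewrite /nc_log /ser_log /ssum big_ord_recl -[LHS]add0r; congr (_ + _).
rewrite big_add1 big_mkord; apply: eq_bigr => n _; rewrite nc_powE serZE.
by congr (_ * ((_ : ser bool) ^+ _) w); apply/serP => -[].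
Qed.

Local Notation X := (var true).
Local Notation Y := (var false).

Lemma vanish_var (I : eqType) (i : I) : vanish 1 (var i).
Proof. by apply/vanish1P. Qed.

Lemma exp_nc_bch :
  vanish 1 (nc_bch : ser bool) /\
  ser_exp (nc_bch : ser bool) = ser_exp X * ser_exp Y.
Proof.
rewrite /nc_bch nc_logE !nc_expE -[nc_mul _ _]/(ser_exp X * ser_exp Y); apply: ser_exp_log.
by rewrite serM_nil !ser_exp_nil mulr1.
Qed.

(** * The Baker-Campbell-Hausdorff series consists of Lie polynomials *)

Section Components.
Variable I : Type.
Implicit Types f g : ser I.

Definition comp n f : ser I := fun w => if size w == n then f w else 0.

Lemma compD n f g : comp n (f + g) = comp n f + comp n g.
Proof. by apply/serP => w; rewrite serDE /comp; case: ifP; rewrite ?addr0. Qed.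

Lemma compZ n c f : comp n (c *: f) = c *: comp n f.
Proof. by apply/serP => w; rewrite serZE /comp; case: ifP; rewrite ?mulr0. Qed.

Lemma compB n f g : comp n (f - g) = comp n f - comp n g.
Proof. by rewrite -[in LHS]scaleN1r compD compZ scaleN1r. Qed.

Lemma comp_eq0 n m f : vanish m f -> (n < m)%N -> comp n f = 0.
Proof.
move=> f0 nm; apply/serP => w; rewrite /comp; case: eqP => // wn.
by rewrite f0 ?wn.
Qed.

Lemma comp_ssum n (F : nat -> ser I) :
  comp n (ssum F) = \sum_(k < n.+1) comp n (F k).
Proof.
apply/serP => w; rewrite ser_sumE /comp /ssum.
by case: eqP => [->//|_]; rewrite big1.
Qed.

Lemma comp_euler n f : comp n (euler f) = n%:R *: comp n f.
Proof.
apply/serP => w; rewrite serZE /comp /euler.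
by case: eqP => [->//|_]; rewrite mulr0.
Qed.

Lemma compM n f g :
  comp n (f * g) = \sum_(k < n.+1) comp k f * comp (n - k)%N g.
Proof.
apply/serP => w; rewrite ser_sumE {1}/comp; case: eqP => [<- {n}|wn].
  under [RHS]eq_bigr do rewrite serME.
  rewrite serME exchange_big /=; apply: eq_bigr => j _.
  have jw : (j <= size w)%N by rewrite -ltnS.
  rewrite (bigD1 j) //= big1 ?addr0 => [|k /negPf kj].
    by rewrite /comp size_takel // size_drop !eqxx.
  by rewrite /comp size_takel // eq_sym val_eqE kj mul0r.
rewrite big1 // => -[k kn] _ /=; rewrite serME big1 // => -[j jw] _ /=.
rewrite /comp size_takel // size_drop; case: (j =P k) => [jk|_]; last by rewrite mul0r.
by case: eqP => [?|_]; [exfalso; apply: wn; lia|rewrite mulr0].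
Qed.

Lemma comp_ad n f g : comp n (ad f g) = \sum_(k < n.+1) ad (comp k f) (comp (n - k)%N g).
Proof.
rewrite compB !compM [X in _ - X](reindex_inj rev_ord_inj) -sumrB /=.
apply: eq_bigr => -[k kn] _ /=; rewrite subSS subKn //.
Qed.

End Components.

Definition is_lie (f : ser bool) : Prop := exists p, nc_of_lie p = f.

Lemma is_lie0 : is_lie 0.
Proof. by exists (LieScale 0 (LieVar true)); apply/serP => w /=; rewrite mul0r. Qed.

Lemma is_lieX b : is_lie (var b). Proof. by exists (LieVar b). Qed.

Lemma is_lieD f g : is_lie f -> is_lie g -> is_lie (f + g).
Proof. by move=> [p <-] [q <-]; exists (LieAdd p q). Qed.

Lemma is_lieZ c f : is_lie f -> is_lie (c *: f).
Proof. by move=> [p <-]; exists (LieScale c p). Qed.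

Lemma is_lieB f g : is_lie f -> is_lie g -> is_lie (f - g).
Proof. by move=> lf lg; rewrite -scaleN1r; apply/is_lieD/is_lieZ. Qed.

Lemma is_lie_ad f g : is_lie f -> is_lie g -> is_lie (ad f g).
Proof. by move=> [p <-] [q <-]; exists (LieBr p q). Qed.

Lemma is_lie_sum n (F : 'I_n -> ser bool) :
  (forall k, is_lie (F k)) -> is_lie (\sum_k F k).
Proof. by move=> lF; elim/big_ind: _ => //; [apply: is_lie0|apply: is_lieD]. Qed.

Definition lie_below n (f : ser bool) := forall m, (m < n)%N -> is_lie (comp m f).

(** For series without constant term, a bracket in degree [n] only involves
    components of degree less than [n]: this makes the induction of
    [is_lie_comp_bch] work. *)
Lemma lie_below_ad n f g : vanish 1 f -> vanish 1 g ->
  lie_below n f -> lie_below n g -> lie_below n.+1 (ad f g).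
Proof.
move=> f0 g0 lf lg m mn; rewrite comp_ad; apply: is_lie_sum => -[k km] /=.
have ad_eq0 (u v : ser bool) : u = 0 \/ v = 0 -> is_lie (ad u v).
  by case=> ->; rewrite /ad mulr0 mul0r subrr; apply: is_lie0.
have [k0|k0] := posnP k; first by apply: ad_eq0; left; rewrite k0 (comp_eq0 f0).
have [mk|mk] := posnP (m - k)%N; first by apply: ad_eq0; right; rewrite mk (comp_eq0 g0).
by apply: is_lie_ad; [apply: lf|apply: lg]; lia.
Qed.

Lemma lie_below_iter_ad n k f g : vanish 1 f -> vanish 1 g ->
  lie_below n f -> lie_below n g -> lie_below n.+1 (iter k.+1 (ad f) g).
Proof.
move=> f0 g0 lf lg.
have it0 j : vanish 1 (iter j (ad f) g).
  elim: j => // j IHj; apply: (@vanish_le _ 1 2) => //.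
  exact: (@vanish_ad _ 1 1).
elim: k => [|k IHk]; first exact: lie_below_ad.
by rewrite iterS; apply: lie_below_ad => // m mn; apply: IHk; apply: ltnW.
Qed.

Lemma iter_ad_self (I : Type) (f : ser I) k : iter k.+1 (ad f) f = 0.
Proof.
elim: k => [|k IHk]; first by rewrite /= /ad subrr.
by rewrite iterS IHk /ad mulr0 mul0r subr0.
Qed.

Lemma ssum_iter_ad_self (I : Type) (f : ser I) (c : nat -> rat) :
  ssum (fun k => c k *: iter k (ad f) f) = c 0%N *: f.
Proof.
rewrite ssum_split (_ : ssum _ = 0) ?addr0 //; apply/serP => w.
by rewrite /ssum big1 // => -[[|k] kw] _ //; rewrite [nat_of_ord _]/= iter_ad_self scaler0.
Qed.

Lemma euler_exp_var (I : eqType) (i : I) :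
  euler (ser_exp (var i)) = var i * ser_exp (var i).
Proof.
have eX : euler (var i) = var i.
  apply/serP => w; rewrite /euler /var; case: eqP => [->|_]; last by rewrite mulr0.
  by rewrite mulr1.
rewrite euler_exp ?eX; last exact: vanish_var.
by rewrite (ssum_iter_ad_self _ (fun k => (k.+1`!)%:R^-1)) invr1 scale1r.
Qed.

Lemma exp_var_comm (I : eqType) (i : I) :
  ser_exp (var i) * var i = var i * ser_exp (var i).
Proof.
rewrite exp_mul_ad; last exact: vanish_var.
by rewrite (ssum_iter_ad_self _ (fun k => (k`!)%:R^-1)) invr1 scale1r.
Qed.

(** Applying [euler] to e^Z = e^X e^Y gives, after cancelling e^Z on the right,
    the equation (e^(ad Z) - 1) / ad Z (D Z) = X + e^(ad Z) Y; its term of index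
    0 on the left is D Z itself. *)
Lemma euler_nc_bch (Z := nc_bch : ser bool) :
  euler Z = X + ssum (fun k => (k`!)%:R^-1 *: iter k (ad Z) Y)
    - ssum (fun k => if k is _.+1 then (k.+1`!)%:R^-1 *: iter k (ad Z) (euler Z) else 0).
Proof.
have [Z0 eZ] := exp_nc_bch.
have {1}-> : euler Z = ssum (fun k => (k.+1`!)%:R^-1 *: iter k (ad Z) (euler Z))
    - ssum (fun k => if k is _.+1 then (k.+1`!)%:R^-1 *: iter k (ad Z) (euler Z) else 0).
  by rewrite [X in X - _]ssum_split /= invr1 scale1r addrK.
congr (_ - _).
apply/subr0_eq/(mul_eq0_unit (ser_exp_nil Z)).
rewrite mulrBl mulrDl -exp_mul_ad // -euler_exp // [ser_exp _]eZ eulerM !euler_exp_var.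
by rewrite -(exp_var_comm false) !mulrA subrr.
Qed.

(** In degree [n], [euler_nc_bch] expresses [n] times the component of [Z]
    through X, Y and brackets of components of lower degree. *)
Lemma is_lie_comp_bch n : is_lie (comp n (nc_bch : ser bool)).
Proof.
have [n0 mn] := ubnP n; elim: n0 n mn => // n0 IH n; rewrite ltnS => nn0.
have [Z0 _] := exp_nc_bch; set Z : ser bool := nc_bch in Z0 *.
have [->|npos] := posnP n.
  by rewrite (comp_eq0 Z0) //; apply: is_lie0.
have lZ : lie_below n Z by move=> m mn; apply: IH; lia.
have lE : lie_below n (euler Z).
  by move=> m mn; rewrite comp_euler; apply/is_lieZ/lZ.
have lX b m : is_lie (comp m (var b)).
  have -> : comp m (var b) = (m == 1%N)%:R *: var b.
    apply/serP => w; rewrite serZE /comp /var; case: (w =P [:: b]) => [->|_] /=.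
      by rewrite mulr1 eq_sym; case: eqP.
    by rewrite mulr0 if_same.
  exact/is_lieZ/is_lieX.
have -> : comp n Z = n%:R^-1 *: comp n (euler Z).
  by rewrite comp_euler scalerA mulVf ?scale1r // pnatr_eq0 -lt0n.
apply: is_lieZ; rewrite euler_nc_bch -/Z compB compD !comp_ssum.
apply: is_lieB; first apply: is_lieD => //.
  apply: is_lie_sum => -[[|k] kn] /=; rewrite compZ; apply: is_lieZ => //.
  by apply: (@lie_below_iter_ad n k) => //; exact: vanish_var.
apply: is_lie_sum => -[[|k] kn] /=.
  by rewrite (comp_eq0 (@vanish0 _ n.+1)) //; apply: is_lie0.
rewrite compZ; apply: is_lieZ.
by apply: (@lie_below_iter_ad n k) => //; exact: vanish1_euler.
Qed.

Lemma bch_series_exists : exists P, is_bch_series P.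
Proof.
have [P PE] := choice is_lie_comp_bch.
by exists P => n w; rewrite PE.
Qed.

(** * Gradings, filtrations and brackets *)

Section Subspace.
Variables (V : lmodType rat) (A : set V).
Hypothesis sA : subspace A.

Lemma subspace0 : A 0. Proof. by case: sA. Qed.

Lemma subspaceD x y : A x -> A y -> A (x + y).
Proof. by move=> Ax Ay; rewrite -[x]scale1r; apply: (proj2 sA). Qed.

Lemma subspaceZ c x : A x -> A (c *: x).
Proof. by move=> Ax; rewrite -[c *: x]addr0; apply: (proj2 sA) => //; case: sA. Qed.

Lemma subspaceN x : A x -> A (- x).
Proof. by move=> Ax; rewrite -scaleN1r; apply: subspaceZ. Qed.

Lemma subspaceB x y : A x -> A y -> A (x - y).
Proof. by move=> Ax Ay; apply/subspaceD/subspaceN. Qed.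

Lemma subspaceBC x y : A (x - y) -> A (y - x).
Proof. by move=> Axy; rewrite -opprB; apply: subspaceN. Qed.

Lemma subspace_trans y x z : A (x - y) -> A (y - z) -> A (x - z).
Proof. by move=> Axy Ayz; rewrite -(subrK y x) -addrA; apply: subspaceD. Qed.

Lemma subspace_sum (J : Type) (r : seq J) (P : pred J) (F : J -> V) :
  (forall j, P j -> A (F j)) -> A (\sum_(j <- r | P j) F j).
Proof.
by move=> AF; elim/big_ind: _ => //; [apply: subspace0|apply: subspaceD].
Qed.

End Subspace.

Section Gradings.
Variables (V : lmodType rat) (gr : int -> set V).
Hypothesis grP : is_grading gr.

(** A decomposition may use a degree several times; collecting repetitions
    reduces it to one along any duplicate-free list of degrees. *)
Lemma sum_count (s t : seq int) (c : int -> V) : uniq t -> {subset s <= t} ->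
  \sum_(i <- s) c i = \sum_(i <- t) (count_mem i s)%:R *: c i.
Proof.
move=> ut; elim: s => [|j s IHs] st.
  by rewrite big_nil big1 // => i _; rewrite scale0r.
rewrite big_cons IHs => [|i si]; last by apply: st; rewrite inE si orbT.
have tj : j \in t by apply: st; rewrite mem_head.
under [RHS]eq_bigr do rewrite /= natrD scalerDl.
rewrite big_split /=; congr (_ + _).
rewrite (bigD1_seq j) //= eqxx scale1r big1 ?addr0 // => i /negPf ij.
by rewrite eq_sym ij scale0r.
Qed.

Lemma gr_decomp x : exists (s : seq int) (c : int -> V),
  [/\ uniq s, forall i, gr i (c i) & x = \sum_(i <- s) c i].
Proof.
have [s [c [gc ->]]] := gr_span grP (x := x) I.
exists (undup s), (fun i => (count_mem i s)%:R *: c i); split.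
- exact: undup_uniq.
- by move=> i; apply: (subspaceZ (gr_subspace grP i)); case: (gc i).
- by apply: sum_count; [apply: undup_uniq|move=> i; rewrite mem_undup].
Qed.

(** The decomposition provided by [graded_subset] need not be the given one, but
    the two agree by independence of the homogeneous parts. *)
Lemma graded_subset_component (A : set V) (s : seq int) (c : int -> V) :
    subspace A -> graded_subset gr A -> uniq s -> (forall i, gr i (c i)) ->
  A (\sum_(i <- s) c i) -> forall i, i \in s -> A (c i).
Proof.
move=> sA gA us gc /gA[s' [c' [gc' eqc]]] i si.
have gs j := gr_subspace grP j.
pose t := undup (s ++ s'); have ut : uniq t by apply: undup_uniq.
have st : {subset s <= t} by move=> j sj; rewrite mem_undup mem_cat sj.
have st' : {subset s' <= t} by move=> j sj; rewrite mem_undup mem_cat sj orbT.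
pose d j := (count_mem j s)%:R *: c j - (count_mem j s')%:R *: c' j.
have gd j : gr j (d j).
  by apply: (subspaceB (gs j)); apply: (subspaceZ (gs j)) => //; case: (gc' j).
have sd0 : \sum_(j <- t) d j = 0.
  by rewrite sumrB -!sum_count // -eqc subrr.
have /subr0_eq := gr_indep grP ut gd sd0 (st i si).
rewrite count_uniq_mem // si scale1r => ->.
by apply: (subspaceZ sA); case: (gc' i).
Qed.

End Gradings.

Section Filtration.
Variable L : cdgl.
Implicit Types x y z : L.

Lemma filt_subspace n : subspace (@filt L n).
Proof. by case: (filt_ideal L n). Qed.

Lemma gr_sub i : subspace (@gr L i). Proof. exact: gr_subspace (grP L) i. Qed.

Lemma filt_le m n x : (m <= n)%N -> filt n x -> filt m x.
Proof.
move=> mn; rewrite -(subnKC mn); elim: (n - m)%N => [|k IHk]; first by rewrite addn0.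
by rewrite addnS => /filt_decr.
Qed.

Lemma filt_one x : filt 1 x. Proof. by rewrite filt1. Qed.

(** Separation of the filtration, for elements that need not be
    homogeneous. *)
Lemma filt_eq0 x : (forall n, filt n x) -> x = 0.
Proof.
have [s [c [us gc ->]]] := gr_decomp (grP L) x => Fx.
rewrite big_seq big1 // => i si; apply: (filt_inj (gc i)) => n.
apply: (graded_subset_component (grP L) (filt_subspace n) _ us gc (Fx n) si).
by case: (filt_ideal L n).
Qed.

Lemma filt_eq x y : (forall n, filt n (x - y)) -> x = y.
Proof. by move=> Fxy; apply/subr0_eq/filt_eq0. Qed.

End Filtration.

Section Bracket.
Variable L : glie.
Implicit Types x y z : L.

HB.instance Definition _ x :=
  GRing.isLinear.Build rat L L _ (br x) (br_linearr x).

Lemma brDl x y z : br (x + y) z = br x z + br y z.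
Proof. by have := br_linearl z 1 x y; rewrite !scale1r. Qed.
Lemma br0l z : br 0 z = 0.
Proof. by have := br_linearl z (-1) 0 0; rewrite scaler0 addr0 scaleN1r addNr. Qed.
Lemma brZl c x z : br (c *: x) z = c *: br x z.
Proof. by have := br_linearl z c x 0; rewrite !addr0 br0l addr0. Qed.
Lemma br0r z : br z 0 = 0. Proof. exact: linear0. Qed.
Lemma brNl x z : br (- x) z = - br x z. Proof. by rewrite -scaleN1r brZl scaleN1r. Qed.
Lemma brBl x y z : br (x - y) z = br x z - br y z. Proof. by rewrite brDl brNl. Qed.
Lemma br_suml (J : Type) (r : seq J) (P : pred J) (F : J -> L) z :
  br (\sum_(j <- r | P j) F j) z = \sum_(j <- r | P j) br (F j) z.
Proof. by apply: (big_morph (br^~ z)) => [x y|]; rewrite ?brDl ?br0l. Qed.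

Lemma br0_gr x y : gr 0 x -> gr 0 y -> gr 0 (br x y).
Proof. by move=> gx gy; rewrite -[0]addr0; apply: br_gr. Qed.

Lemma br0C x y : gr 0 x -> gr 0 y -> br x y = - br y x.
Proof. by move=> gx gy; rewrite (br_antisym gx gy) mul0r expr0z scale1r. Qed.

Lemma br0_jacobi x y z : gr 0 x -> gr 0 y ->
  br x (br y z) = br (br x y) z + br y (br x z).
Proof. by move=> gx gy; rewrite (br_jacobi z gx gy) mul0r expr0z scale1r. Qed.

Lemma br0_self x : gr 0 x -> br x x = 0.
Proof.
move=> gx; have /eqP := br0C gx gx.
rewrite -addr_eq0 -mulr2n -scaler_nat scaler_eq0 pnatr_eq0 => /eqP //.
Qed.

End Bracket.

Section LinearTools.
Variables (V W : lmodType rat) (f : V -> W).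
Hypothesis fl : linear f.
Let F : {linear V -> W} := HB.pack f (GRing.isLinear.Build rat V W _ f fl).

Lemma lin0 : f 0 = 0. Proof. exact: (linear0 F). Qed.
Lemma linD x y : f (x + y) = f x + f y. Proof. exact: (linearD F). Qed.
Lemma linZ c x : f (c *: x) = c *: f x. Proof. by rewrite -[f _]/(F _) linearZ. Qed.
Lemma linB x y : f (x - y) = f x - f y. Proof. exact: (linearB F). Qed.
Lemma linN x : f (- x) = - f x. Proof. exact: (linearN F). Qed.
Lemma lin_sum (J : Type) (r : seq J) (P : pred J) (G : J -> V) :
  f (\sum_(j <- r | P j) G j) = \sum_(j <- r | P j) f (G j).
Proof. exact: (linear_sum F). Qed.

End LinearTools.

(** * Evaluation of Lie polynomials: a Dynkin-Specht-Wever theorem *)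

Section LiePair.
Variables (I : finType) (L : cdgl) (a : I -> L).
Hypothesis a0 : forall i, gr 0 (a i).

(** The graph of evaluation: [lie_pair f x] holds when some Lie polynomial in
    the letters of [I] expands to [f] and takes the value [x] at [a]. That this
    relation is functional is the point of the section. *)
Inductive lie_pair : ser I -> L -> Prop :=
  | LiePair0 : lie_pair 0 0
  | LiePairVar i : lie_pair (var i) (a i)
  | LiePairD f g x y : lie_pair f x -> lie_pair g y -> lie_pair (f + g) (x + y)
  | LiePairZ c f x : lie_pair f x -> lie_pair (c *: f) (c *: x)
  | LiePairBr f g x y : lie_pair f x -> lie_pair g y -> lie_pair (ad f g) (br x y).

Lemma lie_pairB f g x y : lie_pair f x -> lie_pair g y -> lie_pair (f - g) (x - y).
Proof.
by move=> fx gy; rewrite -[- g]scaleN1r -[- y]scaleN1r; apply/LiePairD/LiePairZ.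
Qed.

Lemma lie_pair_sum n (F : 'I_n -> ser I) (x : 'I_n -> L) :
  (forall k, lie_pair (F k) (x k)) -> lie_pair (\sum_k F k) (\sum_k x k).
Proof.
move=> Fx; elim/big_ind2: _ => [|f x1 g x2 fx gx|k _]; first exact: LiePair0.
  exact: LiePairD.
exact: Fx.
Qed.

Lemma lie_pair_gr f x : lie_pair f x -> gr 0 x.
Proof.
elim=> {f x} [|i|f g x y _ gx _ gy|c f x _ gx|f g x y _ gx _ gy] //.
- exact: (subspace0 (gr_sub L 0)).
- exact: (subspaceD (gr_sub L 0)).
- exact: (subspaceZ (gr_sub L 0)).
- exact: br0_gr.
Qed.

(** In the semidirect product of a weighted Lie algebra with its Euler
    derivation, [x] of weight [n] acts on [y] plus [q] times the derivation
    (with a sign) by [(y, q) |-> ([x, y] + n q x, 0)]. *)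
Definition dynkin (n : nat) (x : L) (m : L * rat^o) : L * rat^o :=
  (br x m.1 + (n%:R * m.2) *: x, 0).

Lemma dynkin_is_linear n x : linear (dynkin n x).
Proof.
move=> c [y q] [z r]; congr (_, _) => /=; last by rewrite scaler0 addr0.
rewrite linearP scalerDr scalerA -addrACA -scalerDl; congr (_ + _ *: _).
by rewrite /GRing.scale /=; ring.
Qed.

HB.instance Definition _ n x :=
  GRing.isLinear.Build rat (L * rat^o)%type (L * rat^o)%type _ (dynkin n x)
    (dynkin_is_linear n x).

Lemma dynkin_br k l x y m : gr 0 x -> gr 0 y ->
  dynkin k x (dynkin l y m) - dynkin l y (dynkin k x m) = dynkin (k + l) (br x y) m.
Proof.
move=> gx gy; case: m => z q; congr (_, _) => /=.
rewrite !mulr0 !scale0r !addr0 !linearD !linearZ /= (br0_jacobi z gx gy) (br0C gy gx).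
rewrite opprK natrD mulrDl scalerDl (addrAC (br (br x y) z)) addrA addrK.
by rewrite -addrA [X in _ + X]addrC.
Qed.

Local Notation weight_act := (act (fun i => dynkin 1 (a i))).

(** The values of the components of a Lie polynomial act on [L * rat] as its
    expansion does, since both are compatible with brackets; weights are carried
    by the polynomial, [L] itself having none. *)
Lemma lie_pair_weight f x : lie_pair f x -> exists (c : nat -> L) (N : nat),
  [/\ x = \sum_(n < N) c n, forall n, (N <= n)%N -> c n = 0,
      forall n, gr 0 (c n) /\ filt n (c n), c 0%N = 0 &
      forall n m, weight_act n f m = dynkin n (c n) m].
Proof.
have g0 := gr_sub L 0; have sf := filt_subspace L.
have dyn0 n m : dynkin n 0 m = 0 by rewrite /dynkin br0l scaler0 addr0.
elim=> {f x} [|i|f g x y _ [c [N [-> cN gc c0 fc]]] _ [d [N' [-> dN gd d0 gd']]]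
             |e f x _ [c [N [-> cN gc c0 fc]]]
             |f g x y _ [c [N [-> cN gc c0 fc]]] _ [d [N' [-> dN gd d0 gd']]]].
- exists (fun=> 0), 0%N; split=> //; first by rewrite big_ord0.
    by move=> n; split; apply: subspace0.
  by move=> n m; rewrite act0 dyn0.
- exists (fun n => if n == 1%N then a i else 0), 2; split=> //.
  + by rewrite !big_ord_recl big_ord0 add0r addr0.
  + by case=> [|[]].
  + by case=> [|[|n]] /=; split=> //; try exact: subspace0; apply: filt_one.
  + by move=> n m; rewrite actX; case: eqP => [->|_] //; rewrite dyn0.
- exists (fun n => c n + d n), (maxn N N'); split.
  + rewrite big_split /= (@sum_trunc _ N (maxn N N')) ?leq_maxl // => [|k /andP[/cN]] //.
    by rewrite (@sum_trunc _ N' (maxn N N')) ?leq_maxr // => k /andP[/dN].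
  + by move=> n; rewrite geq_max => /andP[/cN-> /dN->]; rewrite addr0.
  + by move=> n; case: (gc n) (gd n) => ? ? [? ?]; split; apply: subspaceD.
  + by rewrite c0 d0 addr0.
  + move=> n m; rewrite actD fc gd'; congr (_, _) => /=.
    by rewrite brDl scalerDr addrACA.
- exists (fun n => e *: c n), N; split.
  + by rewrite scaler_sumr.
  + by move=> n /cN->; rewrite scaler0.
  + by move=> n; case: (gc n); split; apply: subspaceZ.
  + by rewrite c0 scaler0.
  + move=> n m; rewrite actZ fc; congr (_, _) => /=; last by rewrite scaler0.
    by rewrite brZl scalerDr !scalerA mulrC.
- exists (fun n => \sum_(k < n.+1) br (c k) (d (n - k)%N)), (N + N')%N; split.
  + rewrite -(@sum_triangle _ (N + N') (fun k l => br (c k) (d l))).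
      rewrite -(@sum_trunc _ N (N + N') c) ?leq_addr // => [|k /andP[/cN]] //.
      rewrite -(@sum_trunc _ N' (N + N') d) ?leq_addl // => [|k /andP[/dN]] //.
      by rewrite br_suml; apply: eq_bigr => k _; rewrite linear_sum.
    move=> k l NN; have [Nk|kN] := leqP N k; first by rewrite cN // br0l.
    by rewrite dN ?br0r //; lia.
  + move=> n Nn; rewrite big1 // => -[k kn] _ /=.
    have [Nk|kN] := leqP N k; first by rewrite cN // br0l.
    by rewrite dN ?br0r //; lia.
  + move=> n; split; apply: subspace_sum => // -[k kn] _ /=.
      by apply: br0_gr; [case: (gc k)|case: (gd (n - k)%N)].
    by rewrite -[X in filt X](@subnKC k n) //; apply: filt_br; [case: (gc k)|case: (gd (n - k)%N)].
  + by rewrite big_ord1 c0 br0l.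
  + move=> n m; rewrite actB !actM [X in _ - X](reindex_inj rev_ord_inj) -sumrB /=.
    transitivity (\sum_(k < n.+1) dynkin n (br (c k) (d (n - k)%N)) m).
      apply: eq_bigr => -[k kn] _ /=; rewrite subSS subKn // !fc !gd'.
      rewrite dynkin_br ?subnKC //; first by case: (gc k).
      by case: (gd (n - k)%N).
    symmetry; apply: (big_morph (fun z => dynkin n z m)) => [z z'|]; last exact: dyn0.
    congr (_, _) => /=.
    by rewrite brDl scalerDr addrACA.
Qed.

(** The operator of the component of weight [n] sends (0, 1) to [n] times its
    value: being over the rationals, the expansion determines the value. *)
Lemma lie_pair_filt N f x : lie_pair f x -> vanish N f -> filt N x.
Proof.
move=> /lie_pair_weight[c [M [-> _ gc c0 fc]]] f0.
apply: (subspace_sum (filt_subspace L N)) => -[n nM] _ /=.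
have [Nn|nN] := leqP N n; first by apply: filt_le Nn _; case: (gc n).
suff -> : c n = 0 by apply: (subspace0 (filt_subspace L N)).
case: n nM nN => // n nM nN.
have := fc n.+1 (0, 1); rewrite (act_vanish _ _ f0) // => -[/esym/eqP].
by rewrite br0r add0r mulr1 scaler_eq0 pnatr_eq0 /= => /eqP.
Qed.

Lemma lie_pair_eq0 x : lie_pair 0 x -> x = 0.
Proof. by move=> px; apply: filt_eq0 => n; apply: lie_pair_filt px _. Qed.

(** Past weight 1, the operators of the letters are iterated brackets of the
    [a i]. *)
Lemma lie_pair_commute f x : (forall i j, br (a i) (a j) = 0) ->
  lie_pair f x -> vanish 2 f -> x = 0.
Proof.
move=> aC /lie_pair_weight[c [M [-> _ gc c0 fc]]] f0.
have act1E g : exists t : I -> rat, weight_act 1 g (0, 1) = (\sum_i t i *: a i, 0).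
  exists (fun i => g [:: i]).
  rewrite /= (eq_bigr (fun i => (g [:: i] *: a i, 0) : L * rat^o)) => [|i _].
    by symmetry; apply: (big_morph (fun y : L => (y, 0) : L * rat^o)).
  congr (_, _); rewrite /= scaler0 br0r add0r mul1r.
  by rewrite /GRing.scale /= mulr1.
have act2E n g : weight_act n.+2 g (0, 1) = 0.
  elim: n g => [|n IHn] g; rewrite actS big1 // => i _; last by rewrite IHn linear0.
  have [t ->] := act1E (lquot i g); congr (_, _) => /=.
  rewrite linear_sum mulr0 scale0r addr0 big1 // => j _.
  by rewrite linearZ /= aC scaler0.
rewrite big1 // => -[[|n] nM] _ //=.
have : weight_act n.+1 f (0, 1) = 0.
  by case: n {nM} => [|n]; [rewrite (act_vanish _ _ f0)|apply: act2E].
rewrite fc => -[/eqP].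
by rewrite br0r add0r mulr1 scaler_eq0 pnatr_eq0 /= => /eqP.
Qed.

Lemma lie_pair_subst (u : bool -> ser I) (b : bool -> L) p :
    (forall i, vanish 1 (u i)) -> (forall i, lie_pair (u i) (b i)) ->
  lie_pair (subst u (nc_of_lie p)) (lie_eval (b true) (b false) p).
Proof.
move=> u0 ub; elim: p => [i|p IHp q IHq|c p IHp|p IHp q IHq].
- by rewrite -[nc_of_lie _]/(var i) substX //; case: i; apply: ub.
- rewrite -[nc_of_lie _]/((nc_of_lie p : ser bool) + nc_of_lie q) substD.
  exact: LiePairD.
- by rewrite -[nc_of_lie _]/(c *: (nc_of_lie p : ser bool)) substZ; apply: LiePairZ.
- rewrite -[nc_of_lie _]/(ad (nc_of_lie p : ser bool) (nc_of_lie q)).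
  by rewrite substB !substM //; apply: LiePairBr.
Qed.

End LiePair.

(** * The Baker-Campbell-Hausdorff group *)

Definition subst2 (I : Type) (u v f : ser _) : ser I :=
  subst (fun b : bool => if b then u else v) f.

Section BchSeries.
Variable I : Type.
Implicit Types u v w : ser I.

Let Z : ser bool := nc_bch.

Lemma exp_subst_bch u v : vanish 1 u -> vanish 1 v ->
  vanish 1 (subst2 u v Z) /\ ser_exp (subst2 u v Z) = ser_exp u * ser_exp v.
Proof.
move=> u0 v0; have [Z0 eZ] := exp_nc_bch.
have uv0 (b : bool) : vanish 1 (if b then u else v) by case: b.
split; first exact: subst_vanish.
rewrite -subst_ser_exp // [ser_exp _]eZ substM //.
by rewrite !subst_ser_exp ?substX //; exact: vanish_var.
Qed.

(** Both sides are logarithms of e^u e^v e^w. *)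
Lemma subst_bchA u v w : vanish 1 u -> vanish 1 v -> vanish 1 w ->
  subst2 (subst2 u v Z) w Z = subst2 u (subst2 v w Z) Z.
Proof.
move=> u0 v0 w0.
have [uv0 euv] := exp_subst_bch u0 v0; have [vw0 evw] := exp_subst_bch v0 w0.
have [l0 el] := exp_subst_bch uv0 w0; have [r0 er] := exp_subst_bch u0 vw0.
by apply: ser_exp_inj => //; rewrite el er euv evw mulrA.
Qed.

End BchSeries.

Section Bch.
Variables (P : nat -> lie_poly) (PP : is_bch_series P).

Let Z : ser bool := nc_bch.

Definition bch_poly N : ser bool := \sum_(n < N) (nc_of_lie (P n) : ser bool).

Definition bch_eval (L : glie) N (x y : L) := \sum_(n < N) lie_eval x y (P n).

Lemma vanish_bch_term n : vanish n (nc_of_lie (P n) : ser bool).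
Proof. by move=> w wn; rewrite PP; case: eqP wn => // ->; rewrite ltnn. Qed.

Lemma bch_polyP N : vanish N (bch_poly N - Z).
Proof.
move=> w wN; rewrite serBE /bch_poly ser_sumE (bigD1 (Ordinal wN)) //= PP eqxx.
rewrite big1 ?addr0 ?subrr // => n /negPf; rewrite -val_eqE /= => nw.
by rewrite PP eq_sym nw.
Qed.

Lemma vanish1_bch_poly N : vanish 1 (bch_poly N).
Proof.
apply: vanish_sum => -[[|n] nN] _ /=; last exact: vanish_le (ltn0Sn n) (@vanish_bch_term n.+1).
by apply/vanish1P; rewrite PP /= /nc_bch /nc_log big_geq.
Qed.

Section Eval.
Variable L : cdgl.
Implicit Types a b c x y z : L.

Lemma lie_pair_eval2 a b p :
  lie_pair (fun i : bool => if i then a else b) (nc_of_lie p) (lie_eval a b p).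
Proof.
elim: p => [i|p IHp q IHq|c p IHp|p IHp q IHq].
- exact: (LiePairVar (fun i : bool => if i then a else b) i).
- exact: LiePairD.
- exact: LiePairZ.
- exact: LiePairBr.
Qed.

Lemma lie_eval_gr a b p : gr 0 a -> gr 0 b -> gr 0 (lie_eval a b p).
Proof. by move=> ga gb; apply: lie_pair_gr (lie_pair_eval2 a b p) => -[]. Qed.

Lemma bch_eval_gr N a b : gr 0 a -> gr 0 b -> gr 0 (bch_eval N a b).
Proof. by move=> ga gb; apply: (subspace_sum (gr_sub L 0)) => n _; apply: lie_eval_gr. Qed.

Lemma lie_eval_filt N a b p : gr 0 a -> gr 0 b ->
  vanish N (nc_of_lie p : ser bool) -> filt N (lie_eval a b p).
Proof.
by move=> ga gb p0; apply: lie_pair_filt (lie_pair_eval2 a b p) p0 => -[].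
Qed.

Lemma bch_eval_cauchy M N a b : gr 0 a -> gr 0 b -> (M <= N)%N ->
  filt M (bch_eval N a b - bch_eval M a b).
Proof.
move=> ga gb MN; rewrite /bch_eval -!(big_mkord xpredT (fun n => lie_eval a b (P n))).
rewrite (big_cat_nat (n := M)) //= [X in X - _]addrC addrK big_nat_cond.
apply: (subspace_sum (filt_subspace L M)) => n /andP[/andP[Mn _] _].
by apply: filt_le Mn _; apply: lie_eval_filt => //; apply: vanish_bch_term.
Qed.

(** The steps of the filtration are ideals, hence congruences for the
    bracket. *)
Lemma lie_eval_cong N a a' b b' p :
    gr 0 a -> gr 0 a' -> gr 0 b -> gr 0 b' ->
  filt N (a - a') -> filt N (b - b') -> filt N (lie_eval a b p - lie_eval a' b' p).
Proof.
move=> ga ga' gb gb' aa' bb'; have sf := filt_subspace L N; have sg := gr_sub L 0.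
elim: p => [[]|p IHp q IHq|c p IHp|p IHp q IHq] //=.
- by rewrite opprD addrACA; apply: subspaceD.
- by rewrite -scalerBr; apply: subspaceZ.
set x := lie_eval _ _ p in IHp *; set x' := lie_eval _ _ p in IHp *.
set y := lie_eval _ _ q in IHq *; set y' := lie_eval _ _ q in IHq *.
have -> : br x y - br x' y' = br x (y - y') + br (x - x') y'.
  by rewrite linearB brBl /= addrA subrK.
have [_ _ idl] := filt_ideal L N.
apply: (subspaceD sf); first exact: idl.
rewrite br0C; [|by apply: subspaceB => //; apply: lie_eval_gr|exact: lie_eval_gr].
by apply: (subspaceN sf); apply: idl.
Qed.

Lemma bch_eval_cong N M a a' b b' :
    gr 0 a -> gr 0 a' -> gr 0 b -> gr 0 b' ->
  filt N (a - a') -> filt N (b - b') -> filt N (bch_eval M a b - bch_eval M a' b').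
Proof.
move=> ga ga' gb gb' aa' bb'; rewrite -sumrB.
by apply: (subspace_sum (filt_subspace L N)) => n _; apply: lie_eval_cong.
Qed.

(** [bch] may be computed with [P] whatever series defines it: by
    [lie_pair_eq0], Lie polynomials with the same expansion have the same
    values. *)
Lemma bch_spec a b : gr 0 a -> gr 0 b ->
  gr 0 (bch a b) /\ forall N, filt N (bch a b - bch_eval N a b).
Proof.
move=> ga gb.
have [y gy yP] : exists2 y, gr 0 y & forall N, filt N (y - bch_eval N a b).
  apply: filt_surj => [n|n]; first exact: bch_eval_gr.
  exact: bch_eval_cauchy.
suff -> : bch a b = y by [].
rewrite /bch; case: xgetP => [_ -> [Q QP Qcv]|/(_ y) []].
  have PQ n : lie_eval a b (Q n) = lie_eval a b (P n).
    apply/subr0_eq/(@lie_pair_eq0 _ _ (fun i : bool => if i then a else b)).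
      by case.
    have -> : 0 = (nc_of_lie (Q n) : ser bool) - (nc_of_lie (P n) : ser bool).
      by apply/serP => w; rewrite serBE PP QP subrr.
    by apply: lie_pairB; apply: lie_pair_eval2.
  apply: filt_eq => n; have [N NP] := Qcv n.
  have sf := filt_subspace L n.
  apply: (subspace_trans sf (NP (maxn n N) (leq_maxr _ _))).
  under eq_bigr do rewrite PQ.
  apply: (subspaceBC sf); apply: filt_le (leq_maxl n N) _.
  exact: yP.
exists P => // n; exists n => m nm; apply: filt_le nm _; exact: yP.
Qed.

Lemma bch_eq a b y : gr 0 a -> gr 0 b ->
  (forall N, filt N (y - bch_eval N a b)) -> bch a b = y.
Proof.
move=> ga gb yP; have [_ bP] := bch_spec ga gb.
apply: filt_eq => N; have sf := filt_subspace L N.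
exact: (subspace_trans sf (bP N) (subspaceBC sf (yP N))).
Qed.

Lemma lie_pair_bch (I : finType) (d : I -> L) N (u v : ser I) x y :
    vanish 1 u -> vanish 1 v -> lie_pair d u x -> lie_pair d v y ->
  lie_pair d (subst2 u v (bch_poly N)) (bch_eval N x y).
Proof.
move=> u0 v0 ux vy; rewrite /subst2 /bch_poly subst_sum.
apply: lie_pair_sum => n.
apply: (lie_pair_subst (b := fun i : bool => if i then x else y)); by case.
Qed.

(** Modulo the [N]-th step of the filtration both sides are values at [a], [b],
    [c] of Lie polynomials in three letters, obtained by truncating the series;
    their expansions agree below degree [N] by [subst_bchA], hence so do their
    values by [lie_pair_filt]. *)
Lemma bch_assoc a b c : gr 0 a -> gr 0 b -> gr 0 c ->
  bch a (bch b c) = bch (bch a b) c.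
Proof.
move=> ga gb gc.
have [gab abP] := bch_spec ga gb; have [gbc bcP] := bch_spec gb gc.
have [_ lP] := bch_spec gab gc; have [_ rP] := bch_spec ga gbc.
apply: filt_eq => N; have sf := filt_subspace L N.
pose d (i : option bool) := if i is Some i then if i then a else b else c.
have d0 i : gr 0 (d i) by case: i => [[]|].
pose x := var (Some true); pose y := var (Some false); pose z := var (None : option bool).
have x0 : vanish 1 x by apply: vanish_var.
have y0 : vanish 1 y by apply: vanish_var.
have z0 : vanish 1 z by apply: vanish_var.
have dx : lie_pair d x a by apply: (LiePairVar d (Some true)).
have dy : lie_pair d y b by apply: (LiePairVar d (Some false)).
have dz : lie_pair d z c by apply: (LiePairVar d None).
have s1 (u v : ser (option bool)) : vanish 1 u -> vanish 1 v ->
    vanish 1 (subst2 u v (bch_poly N)).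
  by move=> u0 v0; apply: subst_vanish; apply: vanish1_bch_poly.
have sN (u v u' v' : ser (option bool)) :
    vanish 1 u -> vanish 1 v -> vanish 1 u' -> vanish 1 v' ->
    vanish N (u - u') -> vanish N (v - v') ->
    vanish N (subst2 u v (bch_poly N) - subst2 u' v' Z).
  move=> u0 v0 u'0 v'0 uu' vv'; rewrite -(subrK (subst2 u' v' (bch_poly N)) (subst2 u v _)).
  rewrite -addrA; apply: vanishD; first by apply: subst_cong; case.
  by rewrite /subst2 -substB; apply: subst_vanish; apply: bch_polyP.
have v0 (f : ser (option bool)) : vanish N (f - f) by rewrite subrr.
have Z1 (u v : ser (option bool)) : vanish 1 u -> vanish 1 v -> vanish 1 (subst2 u v Z).
  by move=> u0 w0; case: (exp_subst_bch u0 w0).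
have pl := lie_pair_bch N (s1 _ _ x0 y0) z0 (lie_pair_bch N x0 y0 dx dy) dz.
have pr := lie_pair_bch N x0 (s1 _ _ y0 z0) dx (lie_pair_bch N y0 z0 dy dz).
have /(lie_pair_filt d0 (lie_pairB pr pl)) mid :
    vanish N (subst2 x (subst2 y z (bch_poly N)) (bch_poly N) -
              subst2 (subst2 x y (bch_poly N)) z (bch_poly N)).
  have l := sN _ _ _ _ (s1 _ _ x0 y0) z0 (Z1 _ _ x0 y0) z0
    (sN _ _ _ _ x0 y0 x0 y0 (v0 x) (v0 y)) (v0 z).
  have r := sN _ _ _ _ x0 (s1 _ _ y0 z0) x0 (Z1 _ _ y0 z0) (v0 x)
    (sN _ _ _ _ y0 z0 y0 z0 (v0 y) (v0 z)).
  rewrite -(subst_bchA x0 y0 z0) in r.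
  by have := vanishB r l; rewrite opprB addrA subrK.
apply: (subspace_trans sf (rP N)).
apply: (subspace_trans sf (y := bch_eval N a (bch_eval N b c))).
  by apply: bch_eval_cong => //; [exact: bch_eval_gr|rewrite subrr; apply: subspace0].
apply: (subspace_trans sf mid).
apply: (subspace_trans sf (y := bch_eval N (bch a b) c)).
  apply: bch_eval_cong => //; first exact: bch_eval_gr; last by rewrite subrr; apply: subspace0.
  exact: (subspaceBC sf (abP N)).
exact: (subspaceBC sf (lP N)).
Qed.

Lemma ser_exp_letter (I : eqType) (f : ser I) i : vanish 1 f -> ser_exp f [:: i] = f [:: i].
Proof.
move=> f0; rewrite /ser_exp /ssum !big_ord_recl big_ord0 !serZE expr0 ser1E mulr0 add0r addr0.
by rewrite lift0 expr1 invr1 mul1r.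
Qed.

Lemma nc_bch_letter i : nc_bch [:: i] = 1.
Proof.
have [Z0 /serP/(_ [:: i])] := exp_nc_bch; rewrite ser_exp_letter // => ->.
have eX j := ser_exp_letter i (@vanish_var _ j).
rewrite serME !big_ord_recl big_ord0 /= !eX !ser_exp_nil addr0 mul1r mulr1.
by rewrite /var; case: i {eX}; rewrite /= ?addr0 ?add0r.
Qed.

(** All terms of weight at least 2 vanish; this case contains the unit and
    inverse laws. *)
Lemma bch_commute a b : gr 0 a -> gr 0 b -> br a b = 0 -> bch a b = a + b.
Proof.
move=> ga gb ab; have ba : br b a = 0 by rewrite br0C // ab oppr0.
pose d (i : bool) := if i then a else b.
have d0 i : gr 0 (d i) by case: i.
have dC i j : br (d i) (d j) = 0 by case: i; case: j => //=; apply: br0_self.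
have e0 : lie_eval a b (P 0) = 0.
  apply: (lie_pair_eq0 d0); rewrite (_ : 0 = nc_of_lie (P 0) :> ser bool).
    exact: lie_pair_eval2.
  by apply/serP => w; rewrite PP; case: w => //; rewrite /= /nc_bch /nc_log big_geq.
have e1 : lie_eval a b (P 1) = a + b.
  apply/subr0_eq/(lie_pair_eq0 d0).
  rewrite (_ : 0 = (nc_of_lie (P 1) : ser bool) - (X + Y)).
    apply: lie_pairB; first exact: lie_pair_eval2.
    by apply: LiePairD; [apply: (LiePairVar d true)|apply: (LiePairVar d false)].
  apply/serP => w; rewrite serBE PP; case: w => [|[] [|j w]] //=; rewrite ?nc_bch_letter //.
have e2 n : lie_eval a b (P n.+2) = 0.
  apply: (lie_pair_commute d0 dC (lie_pair_eval2 a b _)).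
  exact: (@vanish_le _ 2 n.+2 _ isT (@vanish_bch_term n.+2)).
apply: bch_eq => // N; have sf := filt_subspace L N.
case: N sf => [|[|N]] sf; [exact: filt_le (filt_one _)|exact: filt_one|].
rewrite /bch_eval !big_ord_recl big1 => [|n _]; last exact: e2.
by rewrite [lie_eval a b (P _)]e0 [lie_eval a b (P _)]e1 add0r addr0 subrr; apply: subspace0.
Qed.

End Eval.

(** The series is made of brackets and the morphism is continuous. *)
Lemma bch_morph (L M : cdgl) (f : L -> M) a b : is_glie_hom f ->
    (forall n x, filt n x -> filt n (f x)) -> gr 0 a -> gr 0 b ->
  f (bch a b) = bch (f a) (f b).
Proof.
move=> [fl fg fb] ff ga gb; have [gab abP] := bch_spec ga gb.
have f_eval p : f (lie_eval a b p) = lie_eval (f a) (f b) p.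
  elim: p => [[]|p IHp q IHq|c p IHp|p IHp q IHq] //=.
  - by rewrite (linD fl) IHp IHq.
  - by rewrite (linZ fl) IHp.
  - by rewrite fb IHp IHq.
symmetry; apply: bch_eq => [||N]; try exact: fg.
have := ff _ _ (abP N); rewrite (linB fl) /bch_eval (lin_sum fl).
by under eq_bigr do rewrite f_eval.
Qed.

End Bch.

Lemma concentrated_gr (L : cdgl) k (x : L) : concentrated L k -> gr k x.
Proof.
move=> Lk; have [s [c [us gc ->]]] := gr_decomp (grP L) x.
apply: (subspace_sum (gr_sub L k)) => i _.
have [<-//|ik] := eqVneq i k.
by rewrite (Lk _ _ ik (gc i)); apply: (subspace0 (gr_sub L k)).
Qed.

Lemma bch_laws (L : cdgl) : concentrated L 0 -> bch_group_laws L.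
Proof.
move=> L0; have g0 (x : L) := concentrated_gr x L0; have [P PP] := bch_series_exists.
split=> [x y z|x|x|x|x]; first exact: (bch_assoc PP).
- by rewrite (bch_commute PP) ?br0l ?add0r.
- by rewrite (bch_commute PP) ?br0r ?addr0.
- by rewrite (bch_commute PP) ?addNr // brNl br0_self ?oppr0.
- by rewrite (bch_commute PP) ?subrr // linearN /= br0_self ?oppr0.
Qed.

(** * Morphisms out of a free complete Lie algebra *)

Section GlieHom.
Variables (P M : glie) (f : P -> M).
Hypothesis fh : is_glie_hom f.

Lemma hom0 : f 0 = 0. Proof. by apply: lin0; case: fh. Qed.
Lemma homD x y : f (x + y) = f x + f y. Proof. by apply: linD; case: fh. Qed.
Lemma homB x y : f (x - y) = f x - f y. Proof. by apply: linB; case: fh. Qed.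
Lemma homN x : f (- x) = - f x. Proof. by apply: linN; case: fh. Qed.

End GlieHom.

Lemma glie_hom_comp (P M N : glie) (g : M -> N) (f : P -> M) :
  is_glie_hom g -> is_glie_hom f -> is_glie_hom (g \o f).
Proof.
move=> [gl gg gb] [fl fg fb]; split=> /=.
- by move=> c x y /=; rewrite fl gl.
- by move=> i x /fg /gg.
- by move=> x y; rewrite fb gb.
Qed.

Lemma filt_brl (L : cdgl) n (x y : L) : filt n x -> filt n (br x y).
Proof.
by move=> fx; apply: (@filt_le _ n (n + 1)); rewrite ?leq_addr //; apply/filt_br/filt_one.
Qed.

Lemma filt_brr (L : cdgl) n (x y : L) : filt n y -> filt n (br x y).
Proof.
move=> fy; apply: (@filt_le _ n (1 + n)); rewrite ?leq_addl //.
by apply: filt_br => //; apply: filt_one.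
Qed.

(** The dual numbers [L + eps L], with [eps] of degree 1, over a Lie algebra
    [L] concentrated in degree 0: lifting a morphism from [L] to them amounts to
    giving a derivation of degree -1 along it. *)
Section DualNumbers.
Variable L : cdgl.
Hypothesis L0 : concentrated L 0.

Let g0 (x : L) : gr 0 x := concentrated_gr x L0.

Definition eps_gr (i : int) : set (L * L)%type :=
  [set m | (i != 0 -> m.1 = 0) /\ (i != 1 -> m.2 = 0)]%classic.

Definition eps_br (m m' : L * L) : L * L :=
  (br m.1 m'.1, br m.1 m'.2 + br m.2 m'.1).

Lemma eps_grading : is_grading eps_gr.
Proof.
split=> [i|[y z] _|s c us gc s0 i si].
- split=> // c x y [x1 x2] [y1 y2]; split=> i0 /=.
    by rewrite x1 // y1 // scaler0 addr0.
  by rewrite x2 // y2 // scaler0 addr0.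
- exists [:: 0; 1], (fun i => (if i == 0 then y else 0, if i == 1 then z else 0)).
  split=> [i|]; first by split=> //; split=> /= /negPf->.
  by rewrite !big_cons big_nil /=; congr (_, _) => /=; rewrite ?addr0 ?add0r.
have s1 : \sum_(j <- s) (c j).1 = 0.
  by have := congr1 fst s0; rewrite raddf_sum.
have s2 : \sum_(j <- s) (c j).2 = 0.
  by have := congr1 snd s0; rewrite raddf_sum.
rewrite [c i]surjective_pairing; congr (_, _).
  have [i0|] := eqVneq i 0; last by case: (gc i).
  rewrite (bigD1_seq i) //= big1 ?addr0 // in s1 => j ji.
  by case: (gc j) => -> //; rewrite -i0.
have [i1|] := eqVneq i 1; last by case: (gc i).
rewrite (bigD1_seq i) //= big1 ?addr0 // in s2 => j ji.
by case: (gc j) => _ -> //; rewrite -i1.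
Qed.

Lemma eps_brC m m' : eps_br m m' = - eps_br m' m.
Proof.
congr (_, _) => /=; first exact: br0C.
by rewrite opprD addrC -!br0C.
Qed.

Lemma eps_br_jacobi x y z :
  eps_br x (eps_br y z) = eps_br (eps_br x y) z + eps_br y (eps_br x z).
Proof.
congr (_, _) => /=; first exact: br0_jacobi.
rewrite !linearD /= !brDl (br0_jacobi z.2 (g0 x.1) (g0 y.1)).
rewrite (br0_jacobi z.1 (g0 x.1) (g0 y.2)) (br0_jacobi z.1 (g0 x.2) (g0 y.1)).
by rewrite (AC ((2 * 2) * 2) ((1 * (3 * 5)) * ((2 * 6) * 4)))%AC.
Qed.

(** The Koszul signs are invisible: they differ from 1 only for two elements of
    [eps L], whose bracket is 0. *)
Lemma eps_sign i j m m' (z : L * L) : eps_gr i m -> eps_gr j m' ->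
  (-1) ^ (i * j) *: eps_br m m' = eps_br m m' /\
  (-1) ^ (i * j) *: eps_br m (eps_br m' z) = eps_br m (eps_br m' z).
Proof.
move=> [m0 _] [m'0 _].
have [->|i0] := eqVneq i 0; first by rewrite mul0r expr0z !scale1r.
have [->|j0] := eqVneq j 0; first by rewrite mulr0 expr0z !scale1r.
have {}m0 := m0 i0; have {}m'0 := m'0 j0.
have e0 (u v : L * L) : u.1 = 0 -> v.1 = 0 -> eps_br u v = 0.
  by move=> u0 v0; congr (_, _) => /=; rewrite u0 v0 !br0l ?br0r ?addr0.
have E : (eps_br m' z).1 = 0 by rewrite /= m'0 br0l.
by rewrite (e0 m m') // (e0 _ _ m0 E) !scaler0.
Qed.

Definition dual_numbers : glie.
Proof.
refine (@Glie (L * L)%type eps_gr eps_br eps_grading _ _ _ _ _).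
- move=> y c x x'; congr (_, _) => /=; first by rewrite brDl brZl.
  by rewrite !brDl !brZl scalerDr addrACA.
- move=> x c y y'; congr (_, _) => /=; first by rewrite linearP.
  by rewrite !linearP /= scalerDr addrACA.
- move=> i j x y [x1 x2] [y1 y2]; split=> /= ij.
    have [i0|/x1->] := eqVneq i 0; last by rewrite br0l.
    by rewrite y1 ?br0r //; apply: contraNneq ij => ->; rewrite i0.
  have -> : br x.1 y.2 = 0.
    have [i0|/x1->] := eqVneq i 0; last by rewrite br0l.
    by rewrite y2 ?br0r //; apply: contraNneq ij => ->; rewrite i0.
  have -> : br x.2 y.1 = 0.
    have [j0|/y1->] := eqVneq j 0; last by rewrite br0r.
    by rewrite x2 ?br0l //; apply: contraNneq ij => ->; rewrite j0.
  by rewrite addr0.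
- move=> i j x y gx gy; rewrite mulrC (eps_sign 0 gy gx).1; exact: eps_brC.
- move=> i j x y z gx gy; rewrite mulrC.
  have [_ ->] := eps_sign z gy gx.
  exact: eps_br_jacobi.
Defined.

End DualNumbers.

Section FreeComplete.
Variables (I : Type) (deg : I -> int) (K : cdgl) (a : I -> K).
Hypothesis Kfree : is_free_complete deg a.

Lemma free_gr i : gr (deg i) (a i).
Proof.
have [P [v [phi [[gv _] [_ gphi _] phiv _ _]]]] := Kfree.
by rewrite -phiv; apply: gphi.
Qed.

Variable L : cdgl.

(** The image of the free Lie algebra is dense. *)
Lemma free_complete_ext (f g : K -> L) : is_glie_hom f -> is_glie_hom g ->
    (forall n x, filt n x -> filt n (f x)) ->
    (forall n x, filt n x -> filt n (g x)) ->
  (forall i, f (a i) = g (a i)) -> f =1 g.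
Proof.
move=> fh gh ff gf fga y.
have [P [v [phi [[gv univ] phih phiv filtphi dense]]]] := Kfree.
have fgphi : f \o phi = g \o phi.
  have [|h [_ hu]] := univ L (fun i => f (a i)).
    by move=> i; case: fh => _ fg _; apply/fg/free_gr.
  rewrite -(hu (f \o phi)); last first.
    by split=> [|i]; [apply: glie_hom_comp|rewrite /= phiv].
  by apply: hu; split=> [|i]; [apply: glie_hom_comp|rewrite /= phiv fga].
apply: filt_eq => n; have [x yx] := dense n y; have sf := filt_subspace L n.
have fgx : f (phi x) = g (phi x) by rewrite -[LHS]/((f \o phi) x) fgphi.
apply: (subspace_trans sf (y := f (phi x))); first by rewrite -homB //; apply: ff.
by rewrite fgx -homB //; apply: gf; apply: (subspaceBC (filt_subspace K n)).
Qed.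

Hypothesis L0 : concentrated L 0.

Let g0 (x : L) : gr 0 x := concentrated_gr x L0.

Lemma hom_neq0 (P : glie) (f : P -> L) i x : is_glie_hom f -> i != 0 -> gr i x -> f x = 0.
Proof. by move=> [_ fg _] i0 /fg; apply: L0. Qed.

(** [f \o diff] is a derivation along [f]. On the free Lie algebra, the lifts of
    [f] to the dual numbers given by it and by 0 agree on the generators, so they
    are equal; density gives the rest. *)
Lemma hom_diff_eq0 (f : K -> L) : is_glie_hom f ->
    (forall n x, filt n x -> filt n (f x)) ->
  (forall i, f (diff (a i)) = 0) -> forall x, f (diff x) = 0.
Proof.
move=> fh ff fda y; have [fl fg fb] := fh.
have [P [v [phi [[gv univ] phih phiv filtphi dense]]]] := Kfree.
have dl := @diff_linear K; have [phil phig phib] := phih.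
have fdbr x z : f (diff (br x z)) = br (f x) (f (diff z)) + br (f (diff x)) (f z).
  have [s [c [us gc ->]]] := gr_decomp (grP K) x.
  rewrite br_suml !(lin_sum dl) !(lin_sum fl) !br_suml -big_split /=.
  apply: eq_bigr => i _; rewrite (diff_br z (gc i)) homD // !fb addrC; congr (_ + _).
  have [->|i0] := eqVneq i 0; first by rewrite expr0z scale1r fb.
  by rewrite (linZ fl) fb (hom_neq0 fh i0 (gc i)) !br0l scaler0.
pose h x : dual_numbers L0 := (f (phi x), f (diff (phi x))).
pose h' x : dual_numbers L0 := (f (phi x), 0).
have hh : is_glie_hom h.
  split=> [c x z|i x gx|x z].
  - by rewrite /h phil dl !fl.
  - have gpx := phig _ _ gx; split=> i0 /=; first exact: (hom_neq0 fh i0 gpx).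
    by apply: (hom_neq0 fh _ (diff_gr gpx)); rewrite subr_eq0.
  - by rewrite /h phib fb fdbr.
have hh' : is_glie_hom h'.
  split=> [c x z|i x gx|x z].
  - by rewrite /h' phil fl; congr (_, _); rewrite /= scaler0 addr0.
  - by split=> i0 //=; exact: (hom_neq0 fh i0 (phig _ _ gx)).
  - by rewrite /h' phib fb; congr (_, _); rewrite /= br0l br0r addr0.
have hh'E : h = h'.
  have [|k [_ ku]] := univ (dual_numbers L0) (fun i => h' (v i)).
    by move=> i; case: hh' => _ gh' _; apply/gh'/gv.
  rewrite -(ku h); first by apply: ku.
  by split=> // i; rewrite /h /h' phiv fda.
apply: filt_eq0 => n; have [x yx] := dense n y.
have := congr1 (fun k => (k x).2) hh'E => /= fdx.
by rewrite -[f _]subr0 -fdx -homB // -(linB dl); apply/ff/filt_diff.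
Qed.

(** The preimage of a step of the filtration is a Lie ideal, and contains long
    brackets because the filtration is multiplicative and starts at 1. *)
Lemma long_ideal_filt (J : Type) (P : glie) (v : J -> P) (F : P -> L) n x :
  is_glie_hom F -> long_ideal v n x -> filt n (F x).
Proof.
move=> Fh; have [Fl Fg Fb] := Fh; have sf := filt_subspace L n.
move=> /(_ [set z | filt n (F z)]%classic); apply=> [|m y nm].
  split=> [|z Fz|z w /= Fw].
  - split=> [|c z w Fz Fw] /=; first by rewrite hom0 //; apply: subspace0.
    by rewrite Fl; apply: (subspaceD sf) => //; apply: subspaceZ.
  - have [s [c [us gc zE]]] := gr_decomp (grP P) z.
    have s0 i : subspace (@gr P i) := gr_subspace (grP P) i.
    exists s, (fun i => if i \in s then c i else 0); split.
      move=> i; case: ifP => si; last first.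
        by split; [apply: subspace0|rewrite /= hom0 //; apply: subspace0].
      split=> //=.
      apply: (@graded_subset_component _ _ (grP L) _ s (F \o c)) => //=.
      + by case: (filt_ideal L n).
      + by move=> j; apply/Fg/gc.
      + by rewrite -(lin_sum Fl) -zE.
    by rewrite zE big_seq [RHS]big_seq; apply: eq_bigr => i ->.
  - by rewrite Fb; apply: filt_brr.
move=> vy; apply: filt_le nm _.
elim: vy => {m y} [i|p q y z _ Fy _ Fz]; first exact: filt_one.
by rewrite Fb; apply: filt_br.
Qed.

(** The morphism is the extension by continuity of the one that the free Lie
    algebra provides: [f y] is the limit of the images of approximations of
    [y], and [uniq] identifies it from any other approximations. *)
Lemma free_complete_hom (m : I -> L) : (forall i, gr (deg i) (m i)) ->
  exists f : K -> L, [/\ is_glie_hom f, forall n x, filt n x -> filt n (f x) &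
    forall i, f (a i) = m i].
Proof.
move=> gm; have [P [v [phi [[gv univ] phih phiv filtphi dense]]]] := Kfree.
have [F [[Fh Fv] _]] := univ L m gm.
have [phil phig phib] := phih; have [Fl Fg Fb] := Fh.
have sL n := filt_subspace L n; have sK n := filt_subspace K n.
have Fphi n x : filt n (phi x) -> filt n (F x).
  by move=> /filtphi; apply: long_ideal_filt.
have /choice[X XP] : forall p : nat * K, exists x, filt p.1 (p.2 - phi x).
  by move=> [n y]; apply: dense.
have lim y : exists z : L, forall n, filt n (z - F (X (n, y))).
  have [//||z _ zP] := @filt_surj L 0 (fun n => F (X (n, y))); last by exists z.
  move=> n; rewrite -homB //; apply: Fphi; rewrite homB //.
  apply: (subspace_trans (sK n) (y := y)).
    by apply: (subspaceBC (sK n)); apply: filt_decr; apply: (XP (n.+1, y)).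
  exact: (XP (n, y)).
have {lim}[f fP] := choice lim.
have char n x y : filt n (y - phi x) -> filt n (f y - F x).
  move=> yx; apply: (subspace_trans (sL n) (fP y n)).
  rewrite -homB //; apply: Fphi; rewrite homB //.
  apply: (subspace_trans (sK n) (y := y)) => //.
  by apply: (subspaceBC (sK n)); apply: (XP (n, y)).
have uniq z y : (forall n, exists2 x, filt n (y - phi x) & filt n (z - F x)) -> f y = z.
  move=> zP; apply: filt_eq => n; have [x yx zx] := zP n.
  by apply: (subspace_trans (sL n) (char _ _ _ yx)); apply: subspaceBC.
exists f; split=> [|n y fy|i]; last first.
- apply: uniq => n; exists (v i); first by rewrite phiv subrr; apply: subspace0.
  by rewrite Fv subrr; apply: subspace0.
- have := char n 0 y; rewrite (hom0 phih) (hom0 Fh) !subr0; exact.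
split=> [c x y|i y gy|x y].
- apply: uniq => n; exists (c *: X (n, x) + X (n, y)).
    rewrite phil opprD addrACA -scalerBr; apply: (subspaceD (sK n)).
      by apply: (subspaceZ (sK n)); apply: (XP (n, x)).
    exact: (XP (n, y)).
  rewrite Fl opprD addrACA -scalerBr; apply: (subspaceD (sL n)) => //.
  exact: (subspaceZ (sL n)).
- have [->//|i0] := eqVneq i 0.
  rewrite (_ : f y = 0); first by apply: subspace0; apply: gr_sub.
  apply: uniq => n; have [x yx] := dense n y.
  have [s [c [us gc xE]]] := gr_decomp (grP P) x.
  (* The component of degree i of an approximation of y still approximates y,
     and F kills it. *)
  have Fci : F (c i) = 0 by apply: (hom_neq0 Fh i0 (gc i)).
  have gK := gr_sub K.
  pose d j := (if j == i then y else 0) - (if j \in s then phi (c j) else 0).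
  have gd j : gr j (d j).
    apply: (subspaceB (gK j)).
      by case: eqP => [->//|_]; apply: subspace0.
    by case: ifP => _; [apply/phig/gc|apply: subspace0].
  pose t := undup (i :: s); have ut : uniq t by apply: undup_uniq.
  have ti : i \in t by rewrite mem_undup mem_head.
  have dE : \sum_(j <- t) d j = y - phi x.
    rewrite sumrB; congr (_ - _).
      rewrite (bigD1_seq i) //= eqxx big1 ?addr0 // => j /negPf ->//.
    rewrite xE (lin_sum phil) -big_mkcond -big_filter; apply: perm_big.
    apply: uniq_perm; rewrite ?filter_uniq // => j.
    by rewrite mem_filter mem_undup inE; case: (j \in s); rewrite ?orbT ?andbF.
  have := @graded_subset_component _ _ (grP K) (filt n) t d (sK n) _ ut gd _ i ti.
  rewrite dE /d eqxx => /(_ _ yx); case: (filt_ideal K n) => _ grf _ /(_ grf).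
  case: ifP => si yc; last first.
    exists 0; first by rewrite (hom0 phih).
    by rewrite (hom0 Fh) subrr; apply: subspace0.
  by exists (c i) => //; rewrite Fci subrr; apply: subspace0.
- apply: uniq => n; exists (br (X (n, x)) (X (n, y))).
    rewrite phib; have fx := XP (n, x); have fy := XP (n, y).
    rewrite (_ : _ - _ = br x (y - phi (X (n, y))) + br (x - phi (X (n, x))) (phi (X (n, y)))).
      by apply: (subspaceD (sK n)); [apply: filt_brr|apply: filt_brl].
    by rewrite linearB brBl /= addrA subrK.
  rewrite Fb (_ : _ - _ = br (f x) (f y - F (X (n, y))) + br (f x - F (X (n, x))) (F (X (n, y)))).
    by apply: (subspaceD (sL n)); [apply: filt_brr|apply: filt_brl].
  by rewrite linearB brBl /= addrA subrK.
Qed.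

End FreeComplete.

(** * Simplices of the realization *)

Lemma card2_ord n (A : {set 'I_n}) : #|A| = 2 ->
  exists r s : 'I_n, (r < s)%N /\ A = [set r; s].
Proof.
move=> /eqP/cards2P[x [y [xy ->]]].
case: (ltngtP x y) => [lt|lt|/val_inj eq]; first by exists x, y.
  by exists y, x; rewrite finset.setUC.
by rewrite eq eqxx in xy.
Qed.

Lemma card3_ord n (A : {set 'I_n}) : #|A| = 3 ->
  exists r s t : 'I_n, (r < s < t)%N /\ A = [set r; s; t].
Proof.
move=> A3; have /card_gt0P[x xA] : (0 < #|A|)%N by rewrite A3.
case: (arg_minnP (fun i : 'I_n => i : nat) xA) => r rA rmin; have {}rA : r \in A by [].
have /card2_ord[s [t [st AE]]] : #|A :\ r| = 2.
  by have := cardsD1 r A; rewrite A3 rA => -[].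
exists r, s, t; split; last by rewrite -finset.setUA -AE finset.setD1K.
have : s \in A :\ r by rewrite AE !inE eqxx.
rewrite !inE => /andP[sr /rmin rs]; rewrite st andbT ltn_neqAle rs andbT.
by rewrite eq_sym.
Qed.

Lemma set2_ord_inj n (r s r' s' : 'I_n) : (r < s)%N -> (r' < s')%N ->
  [set r; s] = [set r'; s'] -> r = r' /\ s = s'.
Proof.
move=> rs rs' E; have := set21 r s; have := set22 r s; rewrite E !inE.
case/orP=> /eqP Es; case/orP=> /eqP Er; split=> //; exfalso; move: rs rs'; rewrite Es Er; lia.
Qed.

Section Simplices.
Variables (C : cosimplicial_cdgl) (a : forall n, {set 'I_n.+1} -> C n).
Hypothesis HC : is_LL a.
Variable L : cdgl.
Hypothesis L0 : concentrated L 0.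

Let laws := bch_laws L0.

Lemma gen_gr n (A : {set 'I_n.+1}) : A != finset.set0 -> gr (#|A|%:Z - 2) (a A).
Proof. by move=> A0; apply: (free_gr (LL_free HC n) (exist _ A A0)). Qed.

Lemma set2_neq0 n (r s : 'I_n) : [set r; s] != finset.set0.
Proof. by apply/finset.set0Pn; exists r; rewrite set21. Qed.

Lemma card_set2 n (r s : 'I_n) : (r < s)%N -> #|[set r; s]| = 2.
Proof. by move=> rs; rewrite cards2 -val_eqE neq_ltn rs. Qed.

Lemma edge_gr n (r s : 'I_n.+1) : (r < s)%N -> gr 0 (a [set r; s]).
Proof. by move=> rs; have := gen_gr (set2_neq0 r s); rewrite card_set2. Qed.

Lemma hom_gen0 n (f : C n -> L) (A : {set 'I_n.+1}) :
  is_glie_hom f -> A != finset.set0 -> #|A| != 2 -> f (a A) = 0.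
Proof.
move=> fh A0 A2; apply: (hom_neq0 L0 fh _ (gen_gr A0)).
by rewrite subr_eq0; apply: contra A2 => /eqP[->].
Qed.

(** The term in the vertex [r] disappears for degree reasons. *)
Lemma hom_triangle n (f : C n -> L) (r s t : 'I_n.+1) : is_glie_hom f ->
    (forall m x, filt m x -> filt m (f x)) -> (r < s < t)%N ->
  f (diff (a [set r; s; t])) =
  bch (bch (f (a [set r; s])) (f (a [set s; t]))) (- f (a [set r; t])).
Proof.
move=> fh ff rst; have [P PP] := bch_series_exists.
have [rs st] := andP rst; have rt := ltn_trans rs st.
have bst : gr 0 (bch (a [set r; s]) (a [set s; t])).
  by case: (bch_spec PP (edge_gr rs) (edge_gr st)).
have fr : f (a [set r]) = 0.
  by apply: hom_gen0; rewrite ?cards1 //; apply/finset.set0Pn; exists r; rewrite inE.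
have grt : gr 0 (- a [set r; t]) by apply/(subspaceN (gr_sub _ 0))/edge_gr.
rewrite (LL_triangle HC rst) (homB fh) (bch_morph PP fh ff bst grt).
rewrite (bch_morph PP fh ff (edge_gr rs) (edge_gr st)) (homN fh).
by case: fh => _ _ ->; rewrite fr br0l subr0.
Qed.

(** Indexed by natural numbers, so that edges may be shifted and composed without
    casts. *)
Definition edge n (f : C n -> L) (r s : nat) : L := f (a [set inord r; inord s]).

Lemma edgeE n (f : C n -> L) (r s : 'I_n.+1) : f (a [set r; s]) = edge f r s.
Proof. by rewrite /edge !inord_val. Qed.

(** The image of the boundary of a triangle vanishes, [diff] being 0 on [L]. *)
Lemma edge_cocycle n (f : cdgl_hom (C n) L) r s t : (r < s < t)%N -> (t <= n)%N ->
  bch (edge f r s) (edge f s t) = edge f r t.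
Proof.
case/andP=> rs st tn; have [fh fd ff] := cdgl_funP f.
have lt : ((inord r : 'I_n.+1) < (inord s : 'I_n.+1))%N /\
           ((inord s : 'I_n.+1) < (inord t : 'I_n.+1))%N.
  by rewrite !inordK; lia.
have := hom_triangle fh ff (introT andP lt).
rewrite fd (L0 _ (diff_gr (concentrated_gr _ L0))) // -!/(edge _ _ _) => E.
rewrite -[LHS](bch0r laws) -[X in bch _ X](bchNl laws (edge f r t)) (bchA laws) -E.
exact: (bch0l laws).
Qed.

(** Generators that are not edges go to 0, and by [edge_cocycle] every edge is a
    product of edges between consecutive vertices. *)
Lemma edges_ext n (f g : cdgl_hom (C n) L) :
  (forall k, (k < n)%N -> edge f k k.+1 = edge g k k.+1) -> f = g.
Proof.
move=> fg; apply: cdgl_hom_ext.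
have [fh _ ff] := cdgl_funP f; have [gh _ gf] := cdgl_funP g.
have fgE r d : (r + d.+1 <= n)%N -> edge f r (r + d.+1)%N = edge g r (r + d.+1)%N.
  elim: d => [|d IHd] rd; first by rewrite addn1; apply: fg; lia.
  have rsd : (r < r + d.+1 < r + d.+2)%N by lia.
  rewrite -(edge_cocycle f rsd rd) -(edge_cocycle g rsd rd) IHd; last by lia.
  by rewrite [(r + d.+2)%N]addnS fg //; lia.
apply: (free_complete_ext (LL_free HC n) fh gh ff gf) => -[A A0] /=.
have [A2|A2] := eqVneq #|A| 2; last by rewrite !hom_gen0.
have [r [s [rs ->]]] := card2_ord A2.
rewrite !edgeE -(subnKC rs) addSnnS; apply: fgE.
by have := ltn_ord s; lia.
Qed.

(** The product [G r * ... * G (r + m - 1)] for [bch]. *)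
Fixpoint edge_path (G : nat -> L) r m : L :=
  if m is m'.+1 then bch (edge_path G r m') (G (r + m')%N) else 0.

Lemma edge_pathD G r m1 m2 :
  edge_path G r (m1 + m2) = bch (edge_path G r m1) (edge_path G (r + m1) m2).
Proof.
elim: m2 => [|m2 IHm] /=; first by rewrite addn0 (bch0r laws).
by rewrite addnS /= IHm -(bchA laws) addnA.
Qed.

(** The image imposed on the generator of [A] by the consecutive edges [G]. *)
Definition gen_value n (G : nat -> L) (A : {set 'I_n.+1}) : L :=
  if [pick p : 'I_n.+1 * 'I_n.+1 | (p.1 < p.2)%N && (A == [set p.1; p.2])]
  is Some p then edge_path G p.1 (p.2 - p.1) else 0.

Lemma gen_value_edge n G (r s : 'I_n.+1) : (r < s)%N ->
  gen_value G [set r; s] = edge_path G r (s - r).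
Proof.
move=> rs; rewrite /gen_value; case: pickP => [p|/(_ (r, s))]; last by rewrite /= rs eqxx.
by case/andP=> pp /eqP/(set2_ord_inj rs pp)[-> ->].
Qed.

Lemma gen_value0 n G (A : {set 'I_n.+1}) : #|A| != 2 -> gen_value G A = 0.
Proof.
move=> A2; rewrite /gen_value; case: pickP => // p /andP[pp /eqP AE].
by rewrite AE card_set2 in A2.
Qed.

(** The morphism of Lie algebras prescribed by [gen_value] commutes with the
    differentials: it kills the differentials of all generators, by degree
    except for triangles, where this is the multiplicativity of paths. *)
Lemma hom_of_edges n (G : nat -> L) : exists f : cdgl_hom (C n) L,
  forall k, (k < n)%N -> edge f k k.+1 = G k.
Proof.
have [|f [fh ff fa]] := free_complete_hom (LL_free HC n) L0
    (m := fun A => gen_value G (sval A)).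
  move=> [A A0] /=; have [A2|A2] := eqVneq #|A| 2.
    by rewrite A2; apply: concentrated_gr.
  by rewrite gen_value0 //; apply: subspace0; apply: gr_sub.
have fA A : A != finset.set0 -> f (a A) = gen_value G A.
  by move=> A0; apply: (fa (exist _ A A0)).
have fE (r s : 'I_n.+1) : (r < s)%N -> f (a [set r; s]) = edge_path G r (s - r).
  by move=> rs; rewrite fA ?set2_neq0 ?gen_value_edge.
have fda (A : {A : {set 'I_n.+1} | A != finset.set0}) : f (diff (a (sval A))) = 0.
  case: A => [A A0] /=; have [A3|A3] := eqVneq #|A| 3.
    have [r [s [t [rst ->]]]] := card3_ord A3; have [rs st] := andP rst.
    rewrite hom_triangle // !fE //; last exact: ltn_trans st.
    have -> : (t - r = (s - r) + (t - s))%N by lia.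
    by rewrite edge_pathD subnKC ?(bchNr laws) // ltnW.
  apply: (hom_neq0 L0 fh _ (diff_gr (gen_gr A0))).
  by rewrite -addrA -opprD subr_eq0; apply: contra A3 => /eqP[->].
have df x : diff (f x) = 0 by apply: (L0 _ (diff_gr (concentrated_gr _ L0))).
have fP : is_cdgl_hom f.
  by split=> // x; rewrite df (hom_diff_eq0 (LL_free HC n) L0).
exists (CdglHom fP) => k kn; have kn' := ltnW kn.
rewrite /edge /= fE !inordK ?ltnS // subSnn /= (bch0l laws) addn0 //.
Qed.

Definition edges n (f : cdgl_hom (C n) L) : {ffun 'I_n -> exp_group laws} :=
  [ffun k : 'I_n => edge f k k.+1].

Lemma edges_bij n : bijective (@edges n).
Proof.
have inj : injective (@edges n).
  move=> f g /ffunP fg; apply: edges_ext => k kn.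
  by have := fg (Ordinal kn); rewrite !ffunE.
have /choice[inv invK] : forall g, exists f, @edges n f = g.
  move=> g; have [f fg] := @hom_of_edges n (fun k => oapp g 0 (insub k)).
  by exists f; apply/ffunP => k; rewrite ffunE fg // valK.
by exists inv => // f; apply: inj; rewrite invK.
Qed.

Lemma edge_coface n (i : 'I_n.+2) (f : cdgl_hom (C n.+1) L) r s :
  (r <= n)%N -> (s <= n)%N ->
  edge (cdgl_comp f (coface i)) r s = edge f (bump i r) (bump i s).
Proof.
move=> rn sn; rewrite /edge /= (LL_coface HC) ?set2_neq0 // imsetU1 imset_set1.
have liftE k : (k <= n)%N -> lift i (inord k : 'I_n.+1) = inord (bump i k).
  move=> kn; apply: val_inj; rewrite /= !inordK ?ltnS //.
  by rewrite /bump; case: (i <= k)%N; lia.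
by rewrite !liftE.
Qed.

(** The coface [i] merges the edges around the vertex [i] into one, and shifts the
    later ones. *)
Lemma edges_face n (i : 'I_n.+2) (f : cdgl_hom (C n.+1) L) :
  edges (cdgl_comp f (coface i)) = bar_face i (edges f).
Proof.
apply/ffunP => k; have kn := ltn_ord k.
rewrite !ffunE edge_coface; try lia.
have upk : up k = k.+1 :> nat by rewrite /= /bump leq0n add1n.
have stk : stay k = k :> nat by [].
rewrite upk stk; case: ifP => ki.
  by congr (edge _ _ _); rewrite /bump; lia.
case: ifP => [/eqP ki'|ki'].
  rewrite -[RHS]/(bch (edge f k k.+1) (edge f k.+1 k.+2)) edge_cocycle; try lia.
  by congr (edge _ _ _); rewrite /bump; lia.
by congr (edge _ _ _); rewrite /bump; lia.
Qed.

(** The codegeneracy [i] collapses the edge from [i] to [i + 1]. *)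
Lemma edges_degen n (i : 'I_n.+1) (f : cdgl_hom (C n) L) :
  edges (cdgl_comp f (codegen i)) = bar_degen i (edges f).
Proof.
have [fh _ _] := cdgl_funP f.
apply/ffunP => k; have kn := ltn_ord k; have iin := ltn_ord i.
have degE : (stay i \in [set inord k; inord k.+1]) &&
    (up i \in [set inord k; inord k.+1]) = (k == i :> nat).
  by rewrite !inE -!val_eqE /= !inordK; rewrite ?/bump; lia.
rewrite !ffunE /edge /= (LL_codegen HC) ?set2_neq0 // degE.
case: unliftP => [j kj|ki] /=; last first.
  by rewrite ki eqxx (hom0 fh).
have kv : k = bump i j :> nat by rewrite kj.
have jn := ltn_ord j.
rewrite ffunE ifF; last by rewrite kv /bump; lia.
rewrite imsetU1 imset_set1 /codegen_vertex /edge; congr (f (a [set _; _])).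
  by congr inord; rewrite inordK; [rewrite kv bumpK|lia].
congr inord; rewrite inordK ?kv; last by rewrite /bump; lia.
by have ub (p q : nat) : unbump p (bump p q).+1 = q.+1 by rewrite /unbump /bump; lia.
Qed.

End Simplices.

Theorem mainTheorem1 (C : cosimplicial_cdgl)
    (a : forall n : nat, {set 'I_n.+1} -> C n) (HC : is_LL a)
    (L : cdgl) (HL : concentrated L 0) :
  exists H : bch_group_laws L,
    sset_iso (realization C L) (bar (exp_group H)).
Proof.
exists (bch_laws HL), (fun n f => edges a HL f); split=> [n|n i f|n i f].
- exact: edges_bij.
- exact: edges_face.
- exact: edges_degen.
Qed.
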